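(* Let $\phi:\mathcal{A}\to\mathcal{B}(\mathcal{H})$ be a unital completely positive map on a unital $\mathrm{C}^*$-algebra $\mathcal{A}$, let $\beta_1,\dots,\beta_k$ be $*$-automorphisms of $\mathcal{A}$, and let $T_1,\dots,T_k\in\mathcal{B}(\mathcal{H})$ be contractions such that for every $a\in\mathcal{A}$, \[\phi(a)=\sum_{i=1}^kT_i\,\phi(\beta_i^{-1}(a))\,T_i^*.\] Then there exist a $*$-homomorphism $\pi:\mathcal{A}\to\mathcal{B}(\mathcal{K})$ on a Hilbert space $\mathcal{K}\supset\mathcal{H}$ and isometries $V_1,\dots,V_k\in\mathcal{B}(\mathcal{K})$ with (pairwise) orthogonal ranges such that for every $a\in\mathcal{A}$, \[\pi(a)=\sum_{i=1}^kV_i\,\pi(\beta_i^{-1}(a))\,V_i^*,\] $\pi$ and $V$ are dilations of $\phi$ and $T$, and $\mathcal{H}$ is co-invariant for $V$.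
   Context: $\pi$ is a dilation of $\phi$ if $\phi(a)=P_{\mathcal{H}}\pi(a)|_{\mathcal{H}}$ for all $a\in\mathcal{A}$. $V$ and $T$ denote the representations of the free semigroup $\mathbb{F}_k^+$ sending the $i$-th generator to $V_i$ and $T_i$ respectively; for a word $w=w_1\cdots w_n$ put $V_w=V_{w_1}\cdots V_{w_n}$, $T_w=T_{w_1}\cdots T_{w_n}$. $V$ is a dilation of $T$ if $T_w=P_{\mathcal{H}}V_w|_{\mathcal{H}}$ for every word $w$, and $\mathcal{H}$ is co-invariant for $V$ if $V_i^*\mathcal{H}\subseteq\mathcal{H}$ for all $i$. *)

(* Defs.v *)
From HB Require Import structures.
From mathcomp Require Import all_boot all_order all_algebra.
From mathcomp Require Import sesquilinear.
From mathcomp Require Import complex.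
From mathcomp Require Import all_classical all_reals topology normedtype.
Set Implicit Arguments.
Unset Strict Implicit.
Unset Printing Implicit Defensive.
Import Order.TTheory GRing.Theory Num.Theory.
Import numFieldNormedType.Exports.
Local Open Scope classical_set_scope.
Local Open Scope ring_scope.

(* Complex Hilbert spaces over the complex numbers [R[i]]. The inner product is
   linear in its first argument and conjugate-linear in its second one; it
   induces the norm for which the space is complete. Norms take their values in
   [R[i]], where [0 <= z] means that [z] is a nonnegative real. *)
HB.mixin Record isHilbert (R : realType) H & CompleteNormedModule R[i] H := {
  inner : {dot H for @Num.conj R[i]};
  inner_normE : forall x : H, inner x x = `|x| ^+ 2
}.

#[short(type="hilbertType")]
HB.structure Definition Hilbert (R : realType) :=
  {H of CompleteNormedModule R[i] H & isHilbert R H}.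

(* Unital C*-algebras (the zero algebra is allowed). The product is a field of
   the mixin because a join of [CompleteNormedModule] and [GRing.PzRing] does
   not fit below [Num.NumDomain]; the ring structure is recovered just after
   the declaration of the structure. *)
HB.mixin Record isCStarAlgebra (R : realType) A
    & CompleteNormedModule R[i] A := {
  cstar_one : A;
  cstar_mul : A -> A -> A;
  cstar_mulA : associative cstar_mul;
  cstar_mul1l : left_id cstar_one cstar_mul;
  cstar_mul1r : right_id cstar_one cstar_mul;
  cstar_mulDl : left_distributive cstar_mul +%R;
  cstar_mulDr : right_distributive cstar_mul +%R;
  cstar_scaleAl : forall (c : R[i]) (a b : A),
    c *: cstar_mul a b = cstar_mul (c *: a) b;
  cstar_scaleAr : forall (c : R[i]) (a b : A),
    c *: cstar_mul a b = cstar_mul a (c *: b);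
  cstar_normM : forall a b : A, `|cstar_mul a b| <= `|a| * `|b|;
  star : A -> A;
  starD : {morph star : a b / a + b};
  starZ : forall (c : R[i]) (a : A), star (c *: a) = Num.conj c *: star a;
  starM : forall a b : A, star (cstar_mul a b) = cstar_mul (star b) (star a);
  starK : involutive star;
  cstar_norm_star : forall a : A, `|cstar_mul (star a) a| = `|a| ^+ 2
}.

#[short(type="cstarAlgType")]
HB.structure Definition CStarAlgebra (R : realType) :=
  {A of CompleteNormedModule R[i] A & isCStarAlgebra R A}.

#[non_forgetful_inheritance]
HB.instance Definition _ (R : realType) (A : cstarAlgType R) :=
  GRing.Zmodule_isPzRing.Build (CStarAlgebra.sort A)
    (@cstar_mulA R A) (@cstar_mul1l R A) (@cstar_mul1r R A)
    (@cstar_mulDl R A) (@cstar_mulDr R A).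

Section Operators.
Variable R : realType.
Implicit Types H K : hilbertType R.

(* Bounded operators: for linear maps, boundedness and continuity agree. *)
Record boundedOp H K := BoundedOp {
  boundedOp_fun :> {linear H -> K};
  boundedOp_continuous : continuous boundedOp_fun
}.

(* For bounded [T], [adj T y] is the unique [z] such that
   [<T x, y> = <x, z>] for all [x] (Riesz); 0 is a dummy default value. *)
Definition adj H K (T : H -> K) (y : K) : H :=
  xget 0 [set z | forall x, inner (T x) y = inner x z].

(* For a closed linear subspace [M], [orthproj M] is the orthogonal projection
   onto [M]; 0 is a dummy default value. *)
Definition orthproj K (M : set K) (y : K) : K :=
  xget 0 [set p | M p /\ forall m, M m -> inner (y - p) m = 0].

Definition contractive H K (T : H -> K) := forall x, `|T x| <= `|x|.

Definition isometric H K (V : H -> K) := forall x, `|V x| = `|x|.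

Definition orthogonal_ranges H K (k : nat) (V : 'I_k -> H -> K) :=
  forall i j, i != j -> forall x y, inner (V i x) (V j y) = 0.

(* [V_w = V_{w_1} ... V_{w_n}], and [V_w = id] for the empty word. *)
Definition word_op H (k : nat) (V : 'I_k -> H -> H) (w : seq 'I_k) : H -> H :=
  foldr (fun i f => V i \o f) id w.

End Operators.

Section Maps.
Variable R : realType.
Implicit Types (A : cstarAlgType R) (H K : hilbertType R).

Definition star_endomorphism A (f : A -> A) :=
  [/\ forall (c : R[i]) (a b : A), f (c *: a + b) = c *: f a + f b,
      forall a b : A, f (a * b) = f a * f b &
      forall a : A, f (star a) = star (f a)].

Record starAut A := StarAut {
  starAut_fun :> A -> A;
  starAut_inv : A -> A;
  starAut_endo : star_endomorphism starAut_fun;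
  starAutK : cancel starAut_fun starAut_inv;
  starAutVK : cancel starAut_inv starAut_fun
}.

Definition op_linear A H (phi : A -> boundedOp H H) :=
  forall (c : R[i]) (a b : A) (x : H),
    phi (c *: a + b) x = c *: phi a x + phi b x.

(* *-homomorphisms [A -> B(K)]; they are not required to be unital. *)
Definition star_representation A K (pi : A -> boundedOp K K) :=
  [/\ op_linear pi,
      forall (a b : A) (x : K), pi (a * b) x = pi a (pi b x) &
      forall (a : A) (x : K), pi (star a) x = adj (pi a) x].

(* Positive elements of the C*-algebra [M_n(A)]. *)
Definition mx_positive A n (a : 'M[A]_n) :=
  exists b : 'M[A]_n, a = (map_mx (@star R A) b)^T *m b.

(* Positivity of a matrix of operators on [H], seen as an operator on the
   direct sum of [n] copies of [H]. *)
Definition opmx_positive H n (S : 'I_n -> 'I_n -> H -> H) :=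
  forall h : 'I_n -> H, 0 <= \sum_i inner (\sum_j S i j (h j)) (h i).

Definition completely_positive A H (phi : A -> boundedOp H H) :=
  op_linear phi /\
  forall n (a : 'M[A]_n), mx_positive a -> opmx_positive (fun i j => phi (a i j)).

Definition op_unital A H (phi : A -> boundedOp H H) := forall x, phi 1 x = x.

(* [S = P_H V|_H], where [H] is regarded as a closed subspace of [K] through a
   linear isometric embedding [J]. *)
Definition is_compression H K (J : H -> K) (V : K -> K) (S : H -> H) :=
  forall x, J (S x) = orthproj (range J) (V (J x)).

Definition map_dilation A H K (J : H -> K)
    (pi : A -> boundedOp K K) (phi : A -> boundedOp H H) :=
  forall a, is_compression J (pi a) (phi a).

Definition tuple_dilation H K (J : H -> K) (k : nat)
    (V : 'I_k -> K -> K) (T : 'I_k -> H -> H) :=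
  forall w : seq 'I_k, is_compression J (word_op V w) (word_op T w).

Definition coinvariant H K (J : H -> K) (k : nat) (V : 'I_k -> K -> K) :=
  forall i x, range J (adj (V i) (J x)).

End Maps.

(* Main.v *)
From HB Require Import structures.
Require Import Defs.
From mathcomp Require Import all_boot all_order all_algebra.
From mathcomp Require Import ring.
From mathcomp Require Import sesquilinear complex.
From mathcomp.multinomials Require freeg.
From mathcomp Require Import all_classical all_reals topology normedtype.
From mathcomp Require Import sequences.
Set Implicit Arguments.
Unset Strict Implicit.
Unset Printing Implicit Defensive.
Import Order.TTheory GRing.Theory Num.Theory.
Import numFieldNormedType.Exports.
Local Open Scope classical_set_scope.
Local Open Scope ring_scope.

(**
Suppose that the dilation exists, and write [b_i] for the inverse of [beta_i].
The relation [pi(a) = sum_i V_i pi(b_i(a)) V_i^*] and the orthogonality of the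
ranges give [V_i^* pi(a) = pi(b_i(a)) V_i^*], and coinvariance together with
compression gives [V_i^* h = T_i^* h] for [h] in [H].  Hence the inner product
of two vectors of the form [V_w pi(a) h], with [w] a word, [a] in [A] and [h]
in [H], is determined by [phi], [beta] and [T]: remove the longest common
prefix of the two words; if both words go on, the vectors are orthogonal;
otherwise carry what remains to the other side with the rules above, and use
[<pi(a) h, pi(b) g> = <phi(b^* a) h, g>].
The proof runs this computation backwards.  It defines the resulting kernel
([dilation_kernel]) on the set of triples [(w, a, h)], shows that it is
positive, takes for [K] the Hilbert space that it generates ([kernel_space]),
and lets [V_i] and [pi(c)] act on the generators by [(w, a, h) |-> (iw, a, h)]
and [(w, a, h) |-> (w, b_w(c) a, h)], where [b_w] composes the [b_i] along
[w].  In this way Stinespring's dilation of [phi] and the dilation of a row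
coisometry to a row unitary are performed in one step.

Positivity rests on the map [coshift i], the action of [V_i^*] on generators:
it strips the letter [i], sends triples that start with another letter to [0],
and sends [([], a, h)] to [([], b_i(a), T_i^* h)].  The hypothesis on [phi]
says precisely that [k(x, y) = sum_i k(coshift i x, coshift i y)] holds for
the Stinespring kernel on triples with empty word.  Iterating the right hand
side [n] times from the Stinespring kernel yields positive kernels, which no
longer change once [n] exceeds the lengths of the two words
([level_kernel_stable]); the kernel is their common value.  The maps on
generators and their formal adjoints ([kernel_shiftl], [kernel_actl]) extend to
bounded operators as soon as the formal adjoint is bounded for the kernel.  For
[V_i] this is the displayed identity for [k]; for [pi(c)] one writes
[1 = c^* c + d^* d] when [|c| < 1] ([cstar_complement]), so that
[|d x|^2 = |x|^2 - |c x|^2] is nonnegative.  Every assertion of the theorem is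
an equality of vectors, and is checked on inner products with generators.

Three general tools are built on the way.  The completion of a positive
semidefinite form on [E] is the closure of [E] in its conjugate dual, which
performs the quotient by null vectors and the completion at the same time and
makes the extension of an operator a precomposition.  Adjoints of operators on
[H] come from the Riesz theorem, proved by minimizing the energy
[|x|^2 - 2 Re f(x)].  The element [d] above is [1 - y], where [y] is the fixed
point of the contraction [y |-> (c^* c + y^2) / 2].
*)

(** * Positive semidefinite forms and completeness of the complex numbers *)

Lemma sqr_normD (C : numDomainType) (W : normedZmodType C) (a b : W) :
  `|a + b| ^+ 2 <= (`|a| ^+ 2 + `|b| ^+ 2) *+ 2.
Proof.
apply: (@le_trans _ _ ((`|a| + `|b|) ^+ 2)).
  by rewrite lerXn2r ?nnegrE ?addr_ge0 ?ler_normD.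
rewrite -subr_ge0 [X in 0 <= X](_ : _ = (`|a| - `|b|) ^+ 2); last by ring.
by apply: real_exprn_even_ge0 => //; apply: realB; exact: normr_real.
Qed.

Section SemiInnerProduct.
Variables (C : numClosedFieldType) (E : lmodType C).
Variable f : {hermitian_sym E for @Num.conj C}.
Hypothesis f_ge0 : forall x, 0 <= f x x.

Lemma hermsymC x y : f x y = (f y x)^*.
Proof. by rewrite hermC expr0 mul1r. Qed.

(** The form is only semidefinite, so [f y y] may vanish; positivity on the
line [x - s f(x,y) y] with a free real parameter [s] covers both cases. *)
Lemma cauchy_schwarz x y : `|f x y| ^+ 2 <= f x x * f y y.
Proof.
have key s : s \is Num.real ->
    0 <= f x x - s *+ 2 * `|f x y| ^+ 2 + s ^+ 2 * `|f x y| ^+ 2 * f y y.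
  move=> sR; have := f_ge0 (x - (s * f x y) *: y).
  rewrite hnormB mul1r !linearZr_LR/= linearZl_LR /=.
  set z := f x y; have conjM a b : (a * b)^* = a^* * b^* :> C by exact: rmorphM.
  rewrite !conjM !(CrealP sR) conjCK normCK.
  congr (0 <= _). ring.
have [fy0|fyN0] := eqVneq (f y y) 0; last first.
  have fy_gt0 : 0 < f y y by rewrite lt_def fyN0 f_ge0.
  have /key : (f y y)^-1 \is Num.real by rewrite realV ger0_real.
  move=> /(mulr_ge0 (ltW fy_gt0)).
  by rewrite -(subr_ge0 (`|f x y| ^+ 2)); congr (0 <= _); field.
(* The remaining inequality is affine in [s]: a large [s] makes it fail. *)
rewrite fy0 mulr0 in key *.
have [-> //|nN0] := eqVneq (`|f x y|^+2) 0.
have n_gt0 : 0 < `|f x y|^+2 by rewrite lt_def nN0 exprn_ge0.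
have /key : (f x x + 1) / `|f x y|^+2 \is Num.real.
  by rewrite realM ?realV ?realD ?real1 ?ger0_real // ltW.
rewrite mulr0 addr0 mulrnAl divfK // => h.
have : 0 <= - (f x x + 2) by move: h; congr (0 <= _); ring.
by rewrite oppr_ge0 => /le_gtF; rewrite ltr_wpDl.
Qed.

Lemma hnormD_le x y : f (x + y) (x + y) <= (f x x + f y y) *+ 2.
Proof.
rewrite -subr_ge0; have := f_ge0 (x - y); congr (0 <= _).
rewrite hnormB hnormD; ring.
Qed.

Lemma sqrt_hnormD x y :
  sqrtC (f (x + y) (x + y)) <= sqrtC (f x x) + sqrtC (f y y).
Proof.
have s0 z : 0 <= sqrtC (f z z) by rewrite sqrtC_ge0.
rewrite -[leRHS]sqrCK ?addr_ge0 // ler_sqrtC ?qualifE /= ?exprn_ge0 ?addr_ge0 //.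
rewrite hnormD mul1r sqrrD !sqrtCK addrAC lerD2r lerD2l.
have h : `|f x y| <= sqrtC (f x x) * sqrtC (f y y).
  rewrite -(@ler_pXn2r _ 2) ?nnegrE ?mulr_ge0 // exprMn !sqrtCK.
  exact: cauchy_schwarz.
apply: le_trans (_ : `|f x y| *+ 2 <= _); last by rewrite ler_wMn2r.
have r : f x y + (f x y)^* \is Num.real.
  by apply/CrealP; rewrite rmorphD /= conjCK addrC.
apply: le_trans (real_ler_norm r) _; apply: le_trans (ler_normD _ _) _.
by rewrite norm_conjC mulr2n.
Qed.
End SemiInnerProduct.

Section ComplexComplete.
Variable R : realType.
Local Notation C := (R[i] : numFieldType).

(** Real and imaginary parts do not increase distances, so they send a Cauchy
filter to Cauchy filters of real numbers. *)
Lemma complex_complete (F : set_system C) :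
  ProperFilter F -> cauchy F -> cvg F.
Proof.
move=> FF /cauchyP Fc.
have le_norm (z : R[i]) : `|complex.Re z|%:C%C <= `|z| /\ `|complex.Im z|%:C%C <= `|z|.
  case: z => a b; rewrite normc_def /= !lecR -!sqrtr_sqr.
  by split; apply: ler_wsqrtr; rewrite ?lerDl ?lerDr ?sqr_ge0.
have le_sum (z : R[i]) : `|z| <= (`|complex.Re z| + `|complex.Im z|)%:C%C.
  case: z => a b; rewrite normc_def /= lecR -[leRHS]ger0_norm ?addr_ge0 // -sqrtr_sqr.
  apply: ler_wsqrtr; rewrite sqrrD !real_normK ?num_real //.
  by rewrite -subr_ge0 [X in 0 <= X](_ : _ = (`|a| * `|b|) *+ 2) ?mulrn_wge0 ?mulr_ge0 //; ring.
have cvgp (p : R[i] -> R) : {morph p : x y / x - y} ->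
    (forall z, `|p z|%:C%C <= `|z|) -> cvg (p @ F).
  move=> pB pl; have pFF : ProperFilter (p @ F) by exact: fmap_proper_filter.
  apply/cauchy_cvgP; apply/(@cauchy_exP R R (p @ F)) => e e0.
  have [|z Fz] := Fc e%:C%C; first by rewrite ltcR.
  exists (p z); change (F (p @^-1` ball (p z) e)).
  apply: filterS Fz => w; rewrite -ball_normE /= -ball_normE /= => zw.
  by rewrite -pB -ltcR; apply: le_lt_trans (pl _) zw.
have /cvg_ex[a Fa] := cvgp _ (@raddfB _ _ (@complex.Re R)) (fun z => (le_norm z).1).
have /cvg_ex[b Fb] := cvgp _ (@raddfB _ _ (@complex.Im R)) (fun z => (le_norm z).2).
apply/cvg_ex; exists (a +i* b)%C; apply/cvgrPdist_le => e e0.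
have /complex_realP[r er] : e \is Num.real by rewrite gtr0_real.
have r0 : 0 < r / 2 by rewrite divr_gt0 // -ltcR -er.
move/cvgrPdist_le : Fa => /(_ _ r0); move/cvgrPdist_le : Fb => /(_ _ r0).
apply: filterS2 => -[x y] /= hb ha.
apply: (le_trans (le_sum _)); rewrite er lecR [leRHS]splitr.
exact: lerD.
Qed.
End ComplexComplete.

(** * Convergence with an explicit rate *)

Section Rates.
Variable R : realType.
Local Notation C := R[i].
Definition rate (n : nat) : C := n.+1%:R^-1.

Lemma rate_gt0 n : 0 < rate n. Proof. by rewrite invr_gt0 ltr0n. Qed.

Lemma rate_ge0 n : 0 <= rate n. Proof. exact: ltW (rate_gt0 n). Qed.

Lemma rate_le m n : (m <= n)%N -> rate n <= rate m.
Proof. by move=> mn; rewrite lef_pV2 ?posrE ?ltr0n // ler_nat ltnS. Qed.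

Lemma rate_lt (e : C) : 0 < e -> exists N, rate N < e.
Proof.
move=> e0; have /complex_realP[x ex] : e \is Num.real by rewrite gtr0_real.
have x0 : 0 < x by rewrite -ltcR -ex.
have hN := archi_boundP (ltW (etrans (invr_gt0 x) x0)).
exists (Num.bound x^-1); rewrite /rate ex -(rmorph_nat (real_complex R)).
rewrite -fmorphV ltcR invf_plt ?posrE ?ltr0n //.
by apply: lt_trans hN _; rewrite ltr_nat.
Qed.

Lemma rate_small (e c : C) : 0 < e -> 0 <= c -> exists N, c * rate N < e.
Proof.
move=> e0 c0; have [|N hN] := @rate_lt (e / (c + 1)).
  by rewrite divr_gt0 // ltr_wpDl.
exists N; apply: (@le_lt_trans _ _ ((c + 1) * rate N)).
  by rewrite ler_wpM2r ?rate_ge0 // lerDl.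
by rewrite mulrC -ltr_pdivlMr // ltr_wpDl.
Qed.

Section Norm.
Variable W : normedModType C.

Lemma rate_cvg (u : nat -> W) l (c : C) :
  (forall n, `|u n - l| ^+ 2 <= c * rate n) -> u @ \oo --> l.
Proof.
move=> h; have c0 : 0 <= c.
  have := le_trans (exprn_ge0 2 (normr_ge0 (u 0%N - l))) (h 0%N).
  by rewrite pmulr_lge0 ?rate_gt0.
apply/cvgrPdist_lt => e e0.
have [N hN] := rate_small (exprn_gt0 2 e0) c0.
exists N => // n /= Nn; rewrite distrC.
rewrite -(@ltr_pXn2r _ 2) ?nnegrE // ?ltW //.
apply: le_lt_trans (h n) _; apply: le_lt_trans hN.
by rewrite ler_wpM2l ?rate_le.
Qed.

Lemma rate_cauchy (u : nat -> W) (c : C) :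
  (forall m n, `|u m - u n| ^+ 2 <= c * (rate m + rate n)) -> cauchy (u @ \oo).
Proof.
move=> h; have c0 : 0 <= c.
  have := le_trans (exprn_ge0 2 (normr_ge0 (u 0%N - u 0%N))) (h 0%N 0%N).
  by rewrite pmulr_lge0 ?addr_gt0 ?rate_gt0.
apply/cauchyP => e e0.
have [N hN] := rate_small (exprn_gt0 2 e0) (mulrn_wge0 2 c0).
exists (u N); exists N => // n /= Nn; rewrite -ball_normE /=.
rewrite -(@ltr_pXn2r _ 2) ?nnegrE // ?ltW //.
apply: le_lt_trans (h N n) _; apply: le_lt_trans hN.
by rewrite mulrnAl -mulrnAr ler_wpM2l // mulr2n lerD2l rate_le.
Qed.
End Norm.

(** The order of [R[i]] is partial, and [0 <= z] means [z = |z|]: the limit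
inherits this equation by continuity of the norm. *)
Lemma cvg_ge0 (u : nat -> C^o) (l : C^o) :
  u @ \oo --> l -> (forall n, 0 <= u n) -> 0 <= l.
Proof.
move=> /cvgrPdist_lt ul u0; suff -> : l = `|l| by [].
apply/eqP; rewrite -subr_eq0 -normr_le0; apply/negPn/negP => h.
have {h} d0 : 0 < `|l - `|l| | / 2.
  by rewrite divr_gt0 // lt_def normr_ge0 andbT; apply: contra h => /eqP->.
have [N _ /(_ N (leqnn N)) /= hN] := ul _ d0.
suff : `|l - `|l| | < `|l - `|l| | by rewrite ltxx.
rewrite [ltRHS]splitr; apply: le_lt_trans (ler_distD (u N) _ _) _.
apply: (ltrD hN); apply: le_lt_trans _ hN.
rewrite -[u N in leLHS]ger0_norm //; apply: le_trans (ler_dist_dist _ _) _.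
by rewrite distrC.
Qed.

(** An inductive predicate rather than an abbreviation: it fixes the topology of
[C^o] on the complex numbers and keeps the convergence statement folded. *)
Variant tends (u : nat -> C) (l : C) : Prop :=
  Tends of (u : nat -> C^o) @ \oo --> (l : C^o).

Lemma tends_cst c : tends (fun=> c) c.
Proof. by constructor; exact: (@cvg_cst C^o c). Qed.

Lemma tendsD u v l m : tends u l -> tends v m -> tends (fun n => u n + v n) (l + m).
Proof. by case=> ul [vm]; constructor; exact: (cvgD ul vm). Qed.

Lemma tendsN u l : tends u l -> tends (fun n => - u n) (- l).
Proof. by case=> ul; constructor; exact: (cvgN ul). Qed.

Lemma tendsM u v l m : tends u l -> tends v m -> tends (fun n => u n * v n) (l * m).
Proof. by case=> ul [vm]; constructor; exact: (cvgM ul vm). Qed.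

Lemma tends_conj u l : tends u l -> tends (fun n => (u n)^*) l^*.
Proof.
case=> /cvgrPdist_lt ul; constructor; apply/cvgrPdist_lt => e /ul.
by apply: filterS => n /=; rewrite -rmorphB norm_conjC.
Qed.

Lemma tends_norm u l : tends u l -> tends (fun n => `|u n|) `|l|.
Proof.
case=> /cvgrPdist_lt ul; constructor; apply/cvgrPdist_lt => e /ul.
by apply: filterS => n /=; apply: le_lt_trans; apply: ler_dist_dist.
Qed.

Lemma tends_unique u l m : tends u l -> tends u m -> l = m.
Proof. by case=> ul [um]; apply: cvg_unique ul um; exact: norm_hausdorff. Qed.

Lemma tends_le u v l m : tends u l -> tends v m -> (forall n, u n <= v n) -> l <= m.
Proof.
case=> ul [vm] uv; rewrite -subr_ge0; apply: (cvg_ge0 (cvgB vm ul)) => n.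
by rewrite /= subr_ge0.
Qed.

Lemma rate_tends u l c : (forall n, `|u n - l| ^+ 2 <= c * rate n) -> tends u l.
Proof. by move=> h; constructor; exact: (@rate_cvg C^o _ _ c). Qed.

Lemma tends_rate : tends rate 0.
Proof.
apply: (@rate_tends _ _ 1) => n; rewrite subr0 mul1r ger0_norm ?rate_ge0 //.
by rewrite expr2 ler_piMr ?rate_ge0 // invf_le1 ?ler1n ?ltr0n.
Qed.

Lemma rate_cauchy_tends u c :
  (forall m n, `|u m - u n| ^+ 2 <= c * (rate m + rate n)) -> exists l, tends u l.
Proof.
move=> /(@rate_cauchy C^o)/complex_complete h.
by exists (lim ((u : nat -> C^o) @ \oo)); constructor.
Qed.

End Rates.

(** * The Hilbert space of a positive semidefinite form *)

Record psdForm (C : numClosedFieldType) (E : lmodType C) := PsdForm {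
  psd_form :> {hermitian_sym E for @Num.conj C};
  psd_ge0 : forall x, 0 <= psd_form x x
}.

Section Completion.
Variables (R : realType).
Local Notation C := R[i].
Variables (E : lmodType C) (f : psdForm E).
Let q x := f x x.
Let q_ge0 x : 0 <= q x := psd_ge0 f x.
Let fDr u x y : f u (x + y) = f u x + f u y. Proof. exact: linearDr. Qed.
Let fZr u c x : f u (c *: x) = c^* * f u x. Proof. exact: linearZr_LR. Qed.
Let fBl u v x : f (u - v) x = f u x - f v x. Proof. exact: linearBl. Qed.

(** The form sends [u] to the conjugate-linear functional [f u]; [adherent] is the
closure of the set of these functionals for the dual norm, with the norm of a
functional expressed by its squared bound. *)
Definition adherent : {pred E -> C^o} := fun g => `[< forall e : C, 0 < e ->
  exists u, forall x, `|f u x - g x| ^+ 2 <= e * f x x >].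

Lemma adherent_submod : submod_closed adherent.
Proof.
split=> [|c g h /asboolP gA /asboolP hA]; apply/asboolP => e e0.
  exists 0 => x; rewrite linear0l subr0 normr0 expr0n /=.
  by apply: mulr_ge0; [exact: ltW | exact: q_ge0].
pose k := (`|c| ^+ 2 + 1) *+ 2.
have k0 : 0 < k by rewrite pmulrn_lgt0 // ltr_wpDl // exprn_ge0.
have ek : 0 < e / k by rewrite divr_gt0.
have [u hu] := gA _ ek; have [v hv] := hA _ ek.
exists (c *: u + v) => x; rewrite linearDl /= linearZl_LR /=.
rewrite [X in `|X|](_ : _ = c * (f u x - g x) + (f v x - h x)); last first.
  by rewrite -[(c *: g + h) x]/(c * g x + h x); ring.
apply: le_trans (sqr_normD _ _) _; rewrite normrM exprMn.
rewrite [leRHS](_ : _ = (`|c| ^+ 2 * (e / k * f x x) + e / k * f x x) *+ 2).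
  by rewrite ler_wMn2r // lerD // ler_wpM2l // exprn_ge0.
by rewrite -[X in _ + X]mul1r -mulrDl -mulrnAl -/k mulrA mulrCA divff ?mulr1 // gt_eqF.
Qed.

HB.instance Definition _ :=
  GRing.isSubmodClosed.Build C (E -> C^o) adherent adherent_submod.

(** Vectors are functionals: two approximating sequences that differ by a null
sequence are then equal on the nose, and no quotient is needed. *)
Record completion := Completion {
  dual : E -> C^o;
  dual_adherent : dual \in adherent }.
HB.instance Definition _ := [isSub for dual].
HB.instance Definition _ := [Choice of completion by <:].
HB.instance Definition _ := [SubChoice_isSubLmodule of completion by <:].

Definition dual_eval (g : completion) : E -> C := dual g.
Coercion dual_eval : completion >-> Funclass.

Implicit Types g h : completion.

Lemma approx_ex g n :
  exists u, forall x, `|f u x - g x| ^+ 2 <= rate R n * f x x.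
Proof. by have /asboolP := dual_adherent g; apply; apply: rate_gt0. Qed.

Definition approx g n : E := sval (cid (approx_ex g n)).

Lemma approxP g n x : `|f (approx g n) x - g x| ^+ 2 <= rate R n * q x.
Proof. exact: (svalP (cid (approx_ex g n))). Qed.

Lemma completion_eq g h : (forall x, g x = h x) -> g = h.
Proof. by move=> gh; apply/val_inj/funext. Qed.


Lemma approx_cvg g x : tends (fun n => f (approx g n) x) (g x).
Proof. by apply: (@rate_tends _ _ _ (q x)) => n; rewrite mulrC; exact: approxP. Qed.

Lemma dualD g x y : g (x + y) = g x + g y.
Proof.
apply: (tends_unique (approx_cvg g (x + y))).
have := tendsD (approx_cvg g x) (approx_cvg g y).
by congr tends; apply/funext => n; rewrite fDr.
Qed.

Lemma dualZ g c x : g (c *: x) = c^* * g x.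
Proof.
apply: (tends_unique (approx_cvg g (c *: x))).
have := tendsM (tends_cst c^*) (approx_cvg g x).
by congr tends; apply/funext => n; rewrite fZr.
Qed.

Lemma dualB g x y : g (x - y) = g x - g y.
Proof. by rewrite dualD -scaleN1r dualZ rmorphN1 mulN1r. Qed.

Lemma dual0 g : g 0 = 0.
Proof. by rewrite -(scale0r 0) dualZ conjC0 mul0r. Qed.

Lemma dual_bounded g : exists2 M, 0 <= M & forall x, `|g x| ^+ 2 <= M * q x.
Proof.
exists ((q (approx g 0) + 1) *+ 2) => [|x].
  by rewrite mulrn_wge0 // addr_ge0.
rewrite -[g x](subrK (f (approx g 0) x)) addrC.
apply: le_trans (sqr_normD _ _) _; rewrite mulrnAl ler_wMn2r // mulrDl lerD //.
  exact: cauchy_schwarz (psd_ge0 f) _ _.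
rewrite distrC; apply: le_trans (approxP _ _ _) _.
by rewrite ler_wpM2r // /rate invr1.
Qed.

(** Both approximants are close to the functional [g], so the functional given by
their difference [d] is small; evaluating it at [d] itself gives [q d]. *)
Lemma approx_cauchy g m n :
  q (approx g m - approx g n) <= (rate R m + rate R n) *+ 2.
Proof.
set d := _ - _; have [-> | qN0] := eqVneq (q d) 0.
  by rewrite mulrn_wge0 // addr_ge0 ?rate_ge0.
have q0 : 0 < q d by rewrite lt_def qN0 q_ge0.
rewrite -(ler_pM2r q0) -expr2 -[X in X ^+ 2]ger0_norm //.
rewrite [X in `|X|](_ : _ = (f (approx g m) d - g d) + - (f (approx g n) d - g d));
  last first.
  by rewrite /q {1}/d fBl; ring.
apply: le_trans (sqr_normD _ _) _; rewrite normrN mulrnAl ler_wMn2r //.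
by rewrite mulrDl; apply: lerD; exact: approxP.
Qed.

Lemma ip_ex g h : exists l, tends (fun n => g (approx h n)) l.
Proof.
have [M M0 gM] := dual_bounded g.
apply: (@rate_cauchy_tends _ _ (M *+ 2)) => m n; rewrite -dualB.
by apply: le_trans (gM _) _; rewrite mulrnAl -mulrnAr ler_wpM2l // approx_cauchy.
Qed.

(** [<g, h>] has to be the limit of [<g, h_n>] for [h_n] in [E] tending to [h],
and a functional is its own inner product with vectors of [E].  In this form
linearity in [g] is immediate; [ip_approx] supplies the symmetry. *)
Definition ip g h : C := sval (cid (ip_ex g h)).

Lemma ip_cvg g h : tends (fun n => g (approx h n)) (ip g h).
Proof. exact: (svalP (cid (ip_ex g h))). Qed.

Lemma q_approx_bounded g : exists2 M, 0 <= M & forall n, q (approx g n) <= M.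
Proof.
exists ((2 *+ 2 + q (approx g 0)) *+ 2) => [|n].
  apply: mulrn_wge0; apply: addr_ge0; [exact: mulrn_wge0 | exact: q_ge0].
rewrite -[approx g n](subrK (approx g 0)); apply: le_trans (hnormD_le (psd_ge0 f) _ _) _.
rewrite ler_wMn2r // lerD // (le_trans (approx_cauchy _ _ _)) // ler_wMn2r //.
by rewrite -[2]/(1 + 1) lerD // invf_le1 ?ler1n // ltr0n.
Qed.

Lemma ip_approx g h : tends (fun n => f (approx g n) (approx h n)) (ip g h).
Proof.
have [M M0 hM] := q_approx_bounded h.
have -> : ip g h = ip g h + 0 by rewrite addr0.
have /(tendsD (ip_cvg g h)) :
    tends (fun n => f (approx g n) (approx h n) - g (approx h n)) 0.
  apply: (@rate_tends _ _ _ M) => n; rewrite subr0.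
  by apply: le_trans (approxP _ _ _) _; rewrite mulrC ler_wpM2r ?rate_ge0.
by congr tends; apply/funext => n; rewrite addrC subrK.
Qed.

Lemma ip_herm g h : ip g h = (ip h g)^*.
Proof.
apply: (tends_unique (ip_approx g h)).
have := tends_conj (ip_approx h g).
by congr tends; apply/funext => n; rewrite -hermsymC.
Qed.

Lemma ip_linear h : scalar (ip^~ h).
Proof.
move=> c g g'; apply: (tends_unique (ip_cvg _ _)).
exact: tendsD (tendsM (tends_cst c) (ip_cvg g h)) (ip_cvg g' h).
Qed.

Lemma ip_approx_diag g : tends (fun n => q (approx g n)) (ip g g).
Proof. exact: ip_approx. Qed.

Lemma ip_ge0 g : 0 <= ip g g.
Proof. exact: (tends_le (tends_cst 0) (ip_approx_diag g)). Qed.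

(** With [ip_dual_le], this identifies the Hilbert norm with the dual norm. *)
Lemma ip_le g c : 0 <= c -> (forall x, `|g x| ^+ 2 <= c * q x) -> ip g g <= c.
Proof.
move=> c0 gc; have [-> // | gN0] := eqVneq (ip g g) 0.
have g0 : 0 < ip g g by rewrite lt_def gN0 ip_ge0.
rewrite -(ler_pM2r g0) -expr2 -[X in X ^+ 2]ger0_norm ?ip_ge0 //.
have := tends_norm (ip_cvg g g).
move=> t; rewrite expr2.
apply: (tends_le (tendsM t t) (tendsM (tends_cst c) (ip_approx_diag g))) => n.
by rewrite -expr2; exact: gc.
Qed.

Lemma ip_dual_le g x : `|g x| ^+ 2 <= ip g g * q x.
Proof.
have t := tends_norm (approx_cvg g x); rewrite expr2.
apply: (tends_le (tendsM t t) (tendsM (ip_approx_diag g) (tends_cst (q x)))) => n.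
by rewrite -expr2; exact: cauchy_schwarz (psd_ge0 f) _ _.
Qed.

Lemma ip_eq0 g : ip g g = 0 -> g = 0.
Proof.
move=> g0; apply: completion_eq => x; apply/eqP.
have := ip_dual_le g x; rewrite g0 mul0r => h.
by rewrite -normr_eq0 -sqrf_eq0 eq_le h exprn_ge0.
Qed.

Lemma embed_adherent x : (f x : E -> C^o) \in adherent.
Proof.
apply/asboolP => e e0; exists x => y; rewrite subrr normr0 expr0n /=.
by apply: mulr_ge0; [exact: ltW | exact: q_ge0].
Qed.

Definition embed x : completion := Completion (embed_adherent x).

(** The reproducing property, which follows by symmetry from the choice of
[approx g]. *)
Lemma ip_embed g x : ip g (embed x) = g x.
Proof.
rewrite ip_herm -[g x]conjCK; congr (_^*); apply: (tends_unique (ip_cvg _ _)).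
have := tends_conj (approx_cvg g x).
by congr tends; apply/funext => n; rewrite -hermsymC.
Qed.


Lemma ip_bilinear : bilinear_for (GRing.Scale.Law.clone _ _ ( *%R ) _)
  (GRing.Scale.Law.clone _ _ (@Num.conj C \; *%R ) _) (ip : completion -> completion -> C).
Proof.
split=> [h c g g' | g c h h']; first exact: ip_linear.
by rewrite ip_herm ip_linear [ip h g]ip_herm [ip h' g]ip_herm rmorphD rmorphM /= !conjCK.
Qed.

HB.instance Definition _ := @bilinear_isBilinear.Build C completion completion C
  _ _ ip ip_bilinear.

Lemma ip_hermitian g h : ip g h = (-1) ^+ false * Num.conj (ip h g).
Proof. by rewrite expr0 mul1r -ip_herm. Qed.

HB.instance Definition _ := @isHermitianSesquilinear.Build C completion
  false (@Num.conj C) ip ip_hermitian.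

Lemma ip_gt0 g : g != 0 -> 0 < ip g g.
Proof.
by move=> gN0; rewrite lt_def ip_ge0 andbT; apply: contra gN0 => /eqP/ip_eq0->.
Qed.

HB.instance Definition _ := @isDotProduct.Build C completion ip ip_gt0.

Definition ip_dot : {dot completion for @Num.conj C} := ip.

Definition dual_norm g : C := sqrtC (ip g g).

Lemma dual_normD g h : dual_norm (g + h) <= dual_norm g + dual_norm h.
Proof. exact: (@sqrt_hnormD _ _ ip_dot ip_ge0). Qed.

Lemma dual_normZ c g : dual_norm (c *: g) = `|c| * dual_norm g.
Proof.
rewrite /dual_norm [ip _ _](@dnormZ _ _ ip_dot c g).
by rewrite sqrtCM ?qualifE /= ?exprn_ge0 ?ip_ge0 // sqrCK.
Qed.

Lemma dual_norm0_eq0 g : dual_norm g = 0 -> g = 0.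
Proof. by move/eqP; rewrite sqrtC_eq0 => /eqP/ip_eq0. Qed.

HB.instance Definition _ := @Lmodule_isNormed.Build C completion
  dual_norm dual_normD dual_normZ dual_norm0_eq0.

Lemma dual_normE g : ip_dot g g = `|g| ^+ 2.
Proof. by rewrite -[RHS]/(dual_norm g ^+ 2) sqrtCK. Qed.

Lemma norm_le_dual g c : 0 <= c -> (forall x, `|g x| ^+ 2 <= c * q x) -> `|g| ^+ 2 <= c.
Proof. by move=> c0 gc; rewrite -dual_normE; exact: ip_le. Qed.

Lemma embedB x y : embed (x - y) = embed x - embed y.
Proof. by apply: completion_eq => z; apply: fBl. Qed.

Lemma embed_norm x : `|embed x| ^+ 2 = q x.
Proof. by rewrite -dual_normE [LHS]ip_embed. Qed.

(** A Cauchy filter concentrates around vectors [e n] of [E]; the functionals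
[f (e n)] converge pointwise, with a rate that is uniform for the dual norm, so
the pointwise limit is adherent and is the limit of the filter. *)
Lemma completion_complete (F : set_system completion) :
  ProperFilter F -> cauchy F -> cvg F.
Proof.
move=> FF /cauchyP Fc.
have /choice[e he] n : exists x, F [set g | `|g - embed x| ^+ 2 <= rate R n].
  have r0 : 0 < rate R n / 4 by rewrite divr_gt0 ?rate_gt0.
  have [|g0 Fg] := Fc (sqrtC (rate R n / 4)); first by rewrite sqrtC_gt0.
  have /asboolP/(_ _ r0)[x hx] := dual_adherent g0.
  exists x; apply: filterS Fg => g; rewrite -ball_normE /= => gg0.
  rewrite -[g](subrK g0) -addrA; apply: le_trans (sqr_normD _ _) _.
  rewrite [leRHS](_ : _ = (rate R n / 4 + rate R n / 4) *+ 2); last by field.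
  rewrite ler_wMn2r // lerD //.
    rewrite -[leRHS]sqrtCK distrC; apply: lerXn2r; last exact: ltW.
      by rewrite nnegrE.
    by rewrite nnegrE sqrtC_ge0 ltW.
  by apply: norm_le_dual => [|y]; [exact: ltW | rewrite distrC; exact: hx].
have e_cauchy m n : q (e m - e n) <= (rate R m + rate R n) *+ 2.
  have [g [/= gm gn]] := filter_ex (filterI (he m) (he n)).
  rewrite -embed_norm embedB -[embed (e m)](subrK g) -addrA.
  by apply: le_trans (sqr_normD _ _) _; rewrite ler_wMn2r // lerD // distrC.
have f_cauchy x m n :
    `|f (e m) x - f (e n) x| ^+ 2 <= (rate R m + rate R n) *+ 2 * q x.
  rewrite -fBl; apply: le_trans (cauchy_schwarz (psd_ge0 f) _ _) _.
  by rewrite ler_wpM2r ?q_ge0 // e_cauchy.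
have lim_e x : exists l, tends (fun n => f (e n) x) l.
  apply: (@rate_cauchy_tends _ _ (q x *+ 2)) => m n.
  by rewrite mulrnAl -mulrnAr mulrC.
pose g x : C^o := sval (cid (lim_e x)).
have g_lim x : tends (fun n => f (e n) x) (g x) := svalP (cid (lim_e x)).
have g_rate n x : `|f (e n) x - g x| ^+ 2 <= rate R n *+ 2 * q x.
  have t := tends_norm (tendsD (tends_cst (f (e n) x)) (tendsN (g_lim x))).
  have t' : tends (fun m => (rate R n + rate R m) *+ 2 * q x) (rate R n *+ 2 * q x).
    have := tendsM (tendsD (tends_cst (rate R n)) (tends_rate R)) (tends_cst (q x *+ 2)).
    by rewrite addr0 mulrnAr -mulrnAl; congr tends; apply/funext => m;
      rewrite mulrnAr -mulrnAl.
  by rewrite expr2; apply: tends_le (tendsM t t) t' _ => m; rewrite -expr2.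
have gA : g \in adherent.
  apply/asboolP => r r0; have [N hN] := @rate_small _ r 2 r0 (ler0n _ _).
  exists (e N) => x; apply: le_trans (g_rate _ _) _.
  by rewrite ler_wpM2r ?q_ge0 // -mulr_natl ltW.
apply/cvg_ex; exists (Completion gA); apply/cvgrPdist_lt => r r0.
have [N hN] := @rate_small _ (r ^+ 2) 6 (exprn_gt0 2 r0) (ler0n _ _).
apply: filterS (he N) => h /= hh.
rewrite -(@ltr_pXn2r _ 2) ?nnegrE // ?ltW //; apply: le_lt_trans hN.
rewrite -[X in X - h](subrK (embed (e N))) -addrA.
apply: le_trans (sqr_normD _ _) _.
rewrite [leRHS](_ : _ = (rate R N *+ 2 + rate R N) *+ 2); last by ring.
rewrite ler_wMn2r // lerD //; last by rewrite distrC.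
apply: norm_le_dual => [|x]; first by rewrite mulrn_wge0 ?rate_ge0.
by rewrite -[X in `|X|]opprB normrN; exact: g_rate.
Qed.

HB.instance Definition _ := Uniform_isComplete.Build completion completion_complete.

HB.instance Definition _ := isHilbert.Build R completion dual_normE.
End Completion.

(** * Operators on the completion, and the Hilbert space of a kernel *)

Section BoundedOps.
Variable R : realType.
Local Notation C := R[i].

Lemma boundedOp_of_bound (H K : hilbertType R) (T : H -> K) (M : C) :
  linear T -> 0 <= M -> (forall x, `|T x| ^+ 2 <= M * `|x| ^+ 2) ->
  exists T' : boundedOp H K, forall x, T' x = T x.
Proof.
move=> Tlin M0 TM.
pose L : {linear H -> K} := HB.pack T (GRing.isLinear.Build _ _ _ _ T Tlin).
have Lc : continuous L.
  apply: bounded_linear_continuous; apply/linear_boundedP.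
  exists (sqrtC M); split; first by rewrite ger0_real ?sqrtC_ge0.
  move=> x Mx y; have x0 : 0 <= x by apply: le_trans (ltW Mx); rewrite sqrtC_ge0.
  rewrite -(@ler_pXn2r _ 2) ?nnegrE ?mulr_ge0 //; apply: le_trans (TM y) _.
  rewrite exprMn ler_wpM2r ?exprn_ge0 // -[leLHS]sqrtCK.
  by apply: lerXn2r; rewrite ?nnegrE ?sqrtC_ge0 // ltW.
by exists (BoundedOp Lc).
Qed.

Variables (E : lmodType C) (f : psdForm E).
(** As vectors are functionals, the extension of [S] to the completion is the
precomposition with its formal adjoint [S']; only [S'] has to be bounded. *)
Lemma dual_precomp (S S' : E -> E) (M : C) : 0 <= M ->
  (forall x y, f (S x) y = f x (S' y)) ->
  (forall x, f (S' x) (S' x) <= M * f x x) ->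
  exists T : boundedOp (completion f) (completion f), forall g x, T g x = g (S' x).
Proof.
move=> M0 SS' S'M.
have adhS (g : completion f) : ((g \o S') : E -> C^o) \in adherent f.
  apply/asboolP => e e0; have M1 : 0 < M + 1 by rewrite ltr_wpDl.
  have /asboolP/(_ (e / (M + 1))) := dual_adherent g; case=> [|u hu].
    by rewrite divr_gt0.
  exists (S u) => x; rewrite SS'; apply: le_trans (hu _) _.
  apply: (@le_trans _ _ (e / (M + 1) * (M * f x x))).
    by rewrite ler_wpM2l // ltW // divr_gt0.
  rewrite mulrA ler_wpM2r ?psd_ge0 // -mulrA ger_pMr // mulrC.
  by rewrite ler_pdivrMr // mul1r lerDl.
pose T g := Completion (adhS g).
have [||x|T' T'E] := @boundedOp_of_bound _ _ T M.
- by move=> c g h; apply: completion_eq.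
- exact: M0.
- apply: norm_le_dual => [|y]; first by rewrite mulr_ge0 ?exprn_ge0.
  apply: le_trans (ip_dual_le x (S' y)) _; rewrite [ip _ _]dual_normE.
  rewrite [leRHS](_ : _ = `|x| ^+ 2 * (M * f y y)); last by ring.
  by apply: ler_wpM2l (S'M y); exact: exprn_ge0.
- by exists T' => g x; rewrite T'E.
Qed.
End BoundedOps.

Section KernelSpace.
Variables (R : realType) (X : choiceType) (k : X -> X -> R[i]).
Local Notation C := R[i].

Definition kernel_form (s t : seq (C * X)) : C :=
  \sum_(p <- s) \sum_(p' <- t) p.1 * p'.1^* * k p.2 p'.2.

Hypothesis k_psd : forall s, 0 <= kernel_form s s.

(** Positivity over the complex numbers forces symmetry: the form of [x + c y] is
real for [c = 1] and [c = i]. *)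
Lemma psd_kernel_herm x y : k x y = (k y x)^*.
Proof.
have real_diag z : (k z z)^* = k z z.
  apply/CrealP/ger0_real; have := k_psd [:: (1, z)].
  by rewrite /kernel_form !big_seq1 /= conjC1 !mul1r.
have conjM (u v : C) : (u * v)^* = u^* * v^* by exact: rmorphM.
have conjD (u v : C) : (u + v)^* = u^* + v^* by exact: rmorphD.
have key c : c^* * k x y + c * k y x = c * (k x y)^* + c^* * (k y x)^*.
  have /ger0_real/CrealP := k_psd [:: (1, x); (c, y)].
  rewrite /kernel_form !(big_cons, big_nil) /= !conjD !conjM !conjCK conjC1.
  rewrite !real_diag => h; apply: (addIr (k x x + c * c^* * k y y)).
  rewrite [LHS](_ : _ = 1 * 1 * k x x + (1 * c^* * k x y + 0) +
    (c * 1 * k y x + (c * c^* * k y y + 0) + 0)); last by ring.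
  by rewrite !addr0 in h *; rewrite -h; ring.
have := key 1; have := key 'i; rewrite conjCi conjC1 !mul1r => h2 h1.
apply: (@mulfI C 2); first by rewrite pnatr_eq0.
apply: (mulfI (neq0Ci C)).
rewrite [LHS](_ : _ = 'i * (k x y + k y x) - (- 'i * k x y + 'i * k y x)); last by ring.
by rewrite h1 h2; ring.
Qed.

Import freeg.
Local Notation E := {freeg X / C}.

Lemma fgliftE (V : lmodType C) (F : X -> V) s :
  fglift F [freeg s] = \sum_(p <- s) p.1 *: F p.2.
Proof. exact: fglift_Freeg. Qed.

Lemma fgscale1 (c : C) x : c *: << x >> = << c *g x >> :> E.
Proof. by apply/eqP/freeg_eqP => y; rewrite coeffZ !coeffU mul1r. Qed.

Lemma freeg_sum (s : seq (C * X)) : [freeg s] = \sum_(p <- s) p.1 *: << p.2 >> :> E.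
Proof.
elim: s => [|p s IH]; first by rewrite freeg_nil big_nil.
by rewrite -cat1s freeg_cat big_cat big_seq1 IH fgscale1 -surjective_pairing.
Qed.

HB.instance Definition _ (V : lmodType C) (F : X -> V) :=
  GRing.isZmodMorphism.Build E V (fglift F) (lift_is_additive F).

Lemma fglift_linear (V : lmodType C) (F : X -> V) : linear (fglift F : E -> V).
Proof.
move=> c D D'; rewrite raddfD; congr (_ + _).
rewrite -(Freeg_enum D); move: (fgenum D) => s.
rewrite fgliftE freeg_sum !scaler_sumr raddf_sum; apply: eq_bigr => p _ /=.
by rewrite scalerA fgscale1 liftU scalerA.
Qed.

Definition free_form (D D' : E) : C :=
  fglift (fun x => (fglift (fun y => (k x y)^* : C^o) D')^* : C^o) D.

Lemma free_formE s t : free_form [freeg s] [freeg t] = kernel_form s t.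
Proof.
rewrite /free_form fgliftE; apply: eq_bigr => p _.
rewrite fgliftE rmorph_sum /= [LHS]mulr_sumr; apply: eq_bigr => p' _.
by rewrite rmorphM /= conjCK mulrA.
Qed.

Lemma free_form_herm D D' : free_form D D' = (free_form D' D)^*.
Proof.
rewrite -(Freeg_enum D) -(Freeg_enum D') !free_formE /kernel_form exchange_big.
rewrite rmorph_sum; apply: eq_bigr => p _; rewrite rmorph_sum.
apply: eq_bigr => p' _ /=; rewrite !rmorphM /= conjCK -psd_kernel_herm; congr (_ * _).
exact: mulrC.
Qed.

Lemma free_form_bilinear : bilinear_for (GRing.Scale.Law.clone _ _ ( *%R ) _)
  (GRing.Scale.Law.clone _ _ (@Num.conj C \; *%R ) _) free_form.
Proof.
split=> [D c D1 D2 | D c D1 D2]; first exact: (@fglift_linear C^o).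
rewrite !(free_form_herm D) [free_form _ _](@fglift_linear C^o).
by rewrite rmorphD rmorphM.
Qed.

HB.instance Definition _ := @bilinear_isBilinear.Build C E E C
  _ _ free_form free_form_bilinear.

Lemma free_form_hermitian (D D' : E) :
  free_form D D' = (-1) ^+ false * Num.conj (free_form D' D).
Proof. by rewrite expr0 mul1r -free_form_herm. Qed.

HB.instance Definition _ := @isHermitianSesquilinear.Build C E
  false (@Num.conj C) free_form free_form_hermitian.

Lemma free_form_ge0 (D : E) : 0 <= (free_form : {hermitian_sym E for @Num.conj C}) D D.
Proof. by rewrite -(Freeg_enum D) [X in 0 <= X]free_formE. Qed.

Definition free_psdForm : psdForm E := PsdForm free_form_ge0.

(** The completion of the free vector space on [X], with the form extended from
the kernel.  Since [pt] is total, an operator is determined by its inner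
products with generators, and the last clause builds one from a map [F] of
generators that has a formal adjoint [G]. *)
Lemma kernel_space : exists (K : hilbertType R) (pt : X -> K),
  [/\ forall x y, inner (pt x) (pt y) = k x y,
      forall g, (forall x, inner g (pt x) = 0) -> g = 0 &
      forall (F G : X -> X) (M : C), 0 <= M ->
        (forall x y, k (F x) y = k x (G y)) ->
        (forall s, kernel_form [seq (p.1, G p.2) | p <- s] [seq (p.1, G p.2) | p <- s]
           <= M * kernel_form s s) ->
        exists T : boundedOp K K, forall g x, inner (T g) (pt x) = inner g (pt (G x))].
Proof.
pose f := free_psdForm.
pose pt x : completion f := embed f << x >>.
have innerE (g : completion f) x : inner g (pt x) = g << x >> by exact: ip_embed.
exists (completion f), pt; split=> [x y | g g0 | F G M M0 FG GM].
- rewrite innerE [LHS]free_formE /kernel_form !big_seq1 /=.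
  by rewrite conjC1 !mul1r.
- apply: completion_eq => D; rewrite -(Freeg_enum D) freeg_sum.
  elim: (fgenum D) => [|p s IH]; first by rewrite big_nil dual0.
  by rewrite big_cons dualD dualZ IH addr0 -innerE g0 mulr0.
pose S (F : X -> X) := fglift (fun x => << F x >> : E).
have SE F' s : S F' [freeg s] = [freeg [seq (p.1, F' p.2) | p <- s]].
  by rewrite /S fgliftE freeg_sum big_map.
have [||T TE] := @dual_precomp R E f (S F) (S G) M M0.
- move=> D D'; rewrite -(Freeg_enum D) -(Freeg_enum D') !SE.
  rewrite [LHS]free_formE [RHS]free_formE /kernel_form big_map.
  by apply: eq_bigr => p _; rewrite big_map; apply: eq_bigr => p' _; rewrite FG.
- by move=> D; rewrite -(Freeg_enum D) SE [leLHS]free_formE [X in _ * X]free_formE.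
exists T => g x; rewrite !innerE TE; congr (g _).
exact: (SE G [:: (1, x)]).
Qed.
End KernelSpace.

(** * Riesz representation and adjoints *)

Section Riesz.
Variable R : realType.
Local Notation C := R[i].

Lemma boundedOp_bound (H K : hilbertType R) (T : boundedOp H K) :
  exists2 M : C, 0 <= M & forall x, `|T x| ^+ 2 <= M * `|x| ^+ 2.
Proof.
have /linear_bounded_continuous/linear_boundedP[M [Mr hM]] := @boundedOp_continuous _ _ _ T.
have MM : M < `|M| + 1 by rewrite (le_lt_trans (real_ler_norm Mr)) // ltrDl.
exists ((`|M| + 1) ^+ 2) => [|x]; first by rewrite exprn_ge0 ?addr_ge0.
by rewrite -exprMn lerXn2r ?nnegrE ?mulr_ge0 ?addr_ge0 ?hM.
Qed.

Lemma innerC (H : hilbertType R) (x y : H) : inner x y = (inner y x)^*.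
Proof. exact: hermsymC. Qed.

Lemma inner_cauchy_schwarz (H : hilbertType R) (x y : H) :
  `|inner x y| ^+ 2 <= `|x| ^+ 2 * `|y| ^+ 2.
Proof.
rewrite -!inner_normE; apply: (@cauchy_schwarz _ _ inner) => z.
exact: dnorm_ge0.
Qed.

Section Functional.
Variables (H : hilbertType R) (f : H -> C) (M : C).
Hypothesis f_lin : scalar f.
Hypothesis M_ge0 : 0 <= M.
Hypothesis f_bound : forall x, `|f x| ^+ 2 <= M * `|x| ^+ 2.

(* The energy [|x|^2 - 2 Re f(x)], minimal at the vector that represents [f]. *)
Let j x : C := `|x| ^+ 2 - (f x + (f x)^*).

Let fD x y : f (x + y) = f x + f y.
Proof. by rewrite -[x]scale1r f_lin mul1r scale1r. Qed.
Let f0 : f 0 = 0.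
Proof. by have /eqP := fD 0 0; rewrite addr0 -subr_eq0 opprD addNKr oppr_eq0 => /eqP. Qed.
Let fZ c x : f (c *: x) = c * f x.
Proof. by rewrite -[c *: x]addr0 f_lin f0 addr0. Qed.

Lemma energy_real x : j x \is Num.real.
Proof.
apply: realB; first by rewrite ger0_real ?exprn_ge0.
by apply/CrealP; rewrite rmorphD /= conjCK addrC.
Qed.

Lemma energy_lower_bound x : - M <= j x.
Proof.
rewrite lerNl opprB lerBlDl.
have s0 : 0 <= sqrtC M by rewrite sqrtC_ge0.
have fs : `|f x| <= sqrtC M * `|x|.
  by rewrite -(@ler_pXn2r _ 2) ?nnegrE ?mulr_ge0 // exprMn sqrtCK.
have r : f x + (f x)^* \is Num.real.
  by apply/CrealP; rewrite rmorphD /= conjCK addrC.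
apply: le_trans (real_ler_norm r) _; apply: le_trans (ler_normD _ _) _.
rewrite norm_conjC -mulr2n; apply: le_trans (_ : sqrtC M * `|x| *+ 2 <= _).
  by rewrite ler_wMn2r.
rewrite -[M in leRHS]sqrtCK -subr_ge0.
rewrite [X in 0 <= X](_ : _ = (`|x| - sqrtC M) ^+ 2); last by ring.
by apply: real_exprn_even_ge0 => //; apply: realB; rewrite ?normr_real ?ger0_real.
Qed.

Lemma energy_inf : exists m : C,
  (forall x, m <= j x) /\ forall e, 0 < e -> exists x, j x < m + e.
Proof.
have jE x : j x = (complex.Re (j x))%:C%C by rewrite RRe_real ?energy_real.
have ME : M = (complex.Re M)%:C%C by rewrite RRe_real ?ger0_real.
pose A := [set complex.Re (j x) | x in [set: H]].
have Ainf : has_inf A.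
  split; first by exists (complex.Re (j 0)), 0.
  exists (- complex.Re M) => _ [x _ <-]; rewrite -lecR rmorphN /= -ME -jE.
  exact: energy_lower_bound.
exists (inf A)%:C%C; split=> [x | e e0].
  by rewrite jE lecR; apply: ge_inf; [exact: Ainf.2 | exists x].
have eE : e = (complex.Re e)%:C%C by rewrite RRe_real ?gtr0_real.
have e0' : 0 < complex.Re e by rewrite -ltcR -eE.
have [_ [x _ <-] hx] := inf_adherent e0' Ainf.
by exists x; rewrite jE eE -rmorphD /= ltcR.
Qed.

(** The energy is [|x|^2] plus a real affine term, so the parallelogram law
shows that minimizing sequences are Cauchy. *)
Lemma energy_parallelogram x y :
  `|x - y| ^+ 2 = (j x + j y) *+ 2 - j (2^-1 *: (x + y)) *+ 4.
Proof.
rewrite /j -!inner_normE fZ fD; set a := f x; set b := f y.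
rewrite linearZl_LR linearZr_LR /= !linearDl !linearDr /= linearNl linearNr linearNl linearNr.
have conjM (u v : C) : (u * v)^* = u^* * v^* by exact: rmorphM.
have conjD (u v : C) : (u + v)^* = u^* + v^* by exact: rmorphD.
have c2 : (2^-1 : C)^* = 2^-1 by rewrite fmorphV /= rmorph_nat.
by rewrite !conjM !c2 !conjD; field.
Qed.

Lemma energy_variation x h c :
  j (x + c *: h) = j x + `|c| ^+ 2 * `|h| ^+ 2
    - (c * (f h - inner h x) + (c * (f h - inner h x))^*).
Proof.
rewrite /j -!inner_normE fD fZ linearDl !linearDr /= !linearZl_LR !linearZr_LR /=.
have conjM (u v : C) : (u * v)^* = u^* * v^* by exact: rmorphM.
have conjD (u v : C) : (u + v)^* = u^* + v^* by exact: rmorphD.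
have conjN (u : C) : (- u)^* = - u^* by exact: rmorphN.
rewrite [inner x h]hermsymC normCK !conjM !conjD !conjM !conjN; ring.
Qed.

(** The first variation of the energy is evaluated along an approximate minimizer
[x n] rather than at the limit, which avoids the continuity of the energy. *)
Lemma riesz : exists z, forall h, f h = inner h z.
Proof.
have [m [mj jm]] := energy_inf.
have /choice[x hx] n : exists x, j x < m + rate R n by apply: jm; apply: rate_gt0.
have x_cauchy : cauchy (x @ \oo).
  apply: (@rate_cauchy _ _ _ (2 : C)) => a b; rewrite energy_parallelogram.
  rewrite lerBlDr; apply: (@le_trans _ _ ((m + rate R a + (m + rate R b)) *+ 2)).
    by rewrite ler_wMn2r // lerD // ltW.
  rewrite [leLHS](_ : _ = 2 * (rate R a + rate R b) + m *+ 4); last by ring.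
  by rewrite lerD2l ler_wMn2r.
have xc : cvgn x by apply: cauchy_cvg.
have /cvgrPdist_lt xz := xc.
set z := limn x in xz; exists z => h.
have fh_lim : tends (fun n => inner h (x n)) (f h).
  pose t : C := (`|h| ^+ 2 + 1)^-1.
  have h1 : 0 < `|h| ^+ 2 + 1 :> C by rewrite ltr_wpDl ?exprn_ge0.
  have t0 : 0 < t by rewrite invr_gt0.
  apply: (@rate_tends _ _ _ (`|h| ^+ 2 + 1)) => n.
  (* Moving [x n] along [h] by [t e^*] would lower the energy by [t |e|^2]. *)
  set e := f h - inner h (x n).
  have := mj (x n + (t * e^*) *: h); rewrite energy_variation -/e.
  have -> : t * e^* * e + (t * e^* * e)^* = t * `|e| ^+ 2 *+ 2.
    have conjM (u v : C) : (u * v)^* = u^* * v^* by exact: rmorphM.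
    by rewrite !conjM conjCK (CrealP (gtr0_real t0)) normCK; ring.
  rewrite normrM norm_conjC (gtr0_norm t0) => hm.
  have ht : t * `|e| ^+ 2 <= rate R n.
    have s1 : (t * `|e|) ^+ 2 * `|h| ^+ 2 <= t * `|e| ^+ 2.
      rewrite [leLHS](_ : _ = t * `|e| ^+ 2 * (`|h| ^+ 2 / (`|h| ^+ 2 + 1))); last first.
        by rewrite /t; ring.
      rewrite ler_piMr ?mulr_ge0 ?exprn_ge0 // ?(ltW t0) //.
      by rewrite ler_pdivrMr // mul1r lerDl.
    rewrite -(lerD2r (t * `|e| ^+ 2 + m)).
    rewrite [leLHS](_ : _ = t * `|e| ^+ 2 *+ 2 + m); last by ring.
    rewrite lerBrDl in hm; apply: le_trans hm _.
    rewrite [leRHS](_ : _ = m + rate R n + t * `|e| ^+ 2); last by ring.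
    by rewrite lerD // ltW.
  rewrite distrC -ler_pdivrMl //.
apply: (tends_unique fh_lim); constructor; apply/cvgrPdist_lt => e e0.
have h1 : 0 < `|h| + 1 :> C by rewrite ltr_wpDl.
have /xz : 0 < e / (`|h| + 1) by rewrite divr_gt0.
apply: filterS => n /= hn; rewrite -linearBr /=.
have : `|inner h (z - x n)| <= `|h| * `|z - x n|.
  rewrite -(@ler_pXn2r _ 2) ?nnegrE ?mulr_ge0 // exprMn.
  exact: inner_cauchy_schwarz.
move=> /le_lt_trans; apply; apply: (@le_lt_trans _ _ ((`|h| + 1) * `|z - x n|)).
  by rewrite ler_wpM2r // lerDl.
by rewrite mulrC -ltr_pdivlMr.
Qed.

End Functional.

Lemma inner_unique (H : hilbertType R) (y z : H) :
  (forall x, inner x y = inner x z) -> y = z.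
Proof.
move=> yz; apply/eqP; rewrite -subr_eq0 -(@dnorm_eq0 _ _ inner).
by rewrite linearBr /= yz subrr.
Qed.

Lemma adj_eq (H K : hilbertType R) (T : H -> K) y z :
  (forall x, inner (T x) y = inner x z) -> adj T y = z.
Proof.
move=> Tz; apply: xget_unique => // z' Tz'.
by apply: inner_unique => x; rewrite -Tz -Tz'.
Qed.

Lemma adjP (H K : hilbertType R) (T : boundedOp H K) x y :
  inner (T x) y = inner x (adj T y).
Proof.
have [M M0 TM] := boundedOp_bound T.
have T_lin : scalar (fun u => inner (T u) y) by move=> c u v; rewrite !linearP linearPl.
have My : 0 <= M * `|y| ^+ 2 by rewrite mulr_ge0 ?exprn_ge0.
have [|z hz] := riesz T_lin My; last by rewrite (adj_eq hz).
move=> u; apply: le_trans (inner_cauchy_schwarz _ _) _.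
rewrite [leRHS](_ : _ = M * `|u| ^+ 2 * `|y| ^+ 2); last by ring.
by apply: ler_wpM2r (TM u); exact: exprn_ge0.
Qed.

Lemma adj_linear (H K : hilbertType R) (T : boundedOp H K) : linear (adj T).
Proof.
move=> c y y'; apply: inner_unique => x.
by rewrite -adjP !linearPr /= !adjP.
Qed.
End Riesz.

(** * Square roots in C*-algebras *)

Section CStar.
Variables (R : realType) (A : cstarAlgType R).
Local Notation C := R[i].
Implicit Types a b c h : A.

Lemma star0 : star (0 : A) = 0.
Proof. by rewrite -{1}(scale0r (0 : A)) starZ conjC0 scale0r. Qed.

Lemma starN a : star (- a) = - star a.
Proof. by rewrite -[- a]scaleN1r starZ rmorphN1 scaleN1r. Qed.

Lemma starB a b : star (a - b) = star a - star b.
Proof. by rewrite starD starN. Qed.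

Lemma starMr a b : star (a * b) = star b * star a.
Proof. exact: starM. Qed.

Lemma cscalerAl (z : C) a b : z *: (a * b) = z *: a * b.
Proof. exact: cstar_scaleAl. Qed.

Lemma cscalerAr (z : C) a b : z *: (a * b) = a * (z *: b).
Proof. exact: cstar_scaleAr. Qed.

Lemma star1 : star (1 : A) = 1.
Proof. by rewrite -[LHS]mulr1 -[X in _ * X]starK -starMr mulr1 starK. Qed.

Lemma star_norm a : `|star a| = `|a|.
Proof.
suff le b : `|b| <= `|star b|.
  by apply: le_anti; rewrite le andbT; have := le (star a); rewrite starK.
have [->|bN0] := eqVneq `|b| 0; first exact: normr_ge0.
have b0 : 0 < `|b| by rewrite lt_def bN0 normr_ge0.
by rewrite -(ler_pM2r b0) -expr2 -cstar_norm_star cstar_normM.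
Qed.

(** Geometric decay beats [1 / (n + 1)], by the inequality of Bernoulli. *)
Lemma bernoulli (r : C) n : 0 <= r -> r < 1 -> r ^+ n * (1 - r) <= rate R n.
Proof.
move=> r0 r1; have d0 : 0 < 1 - r by rewrite subr_gt0.
suff le : r ^+ n * (1 + n%:R * (1 - r)) <= 1.
  rewrite -[leRHS]mul1r ler_pdivlMr ?ltr0n //; apply: le_trans le.
  rewrite -mulrA ler_wpM2l ?exprn_ge0 // mulrC -addn1 natrD mulrDl mul1r addrC.
  by rewrite lerD2r lerBlDr lerDl.
elim: n => [|n]; first by rewrite expr0 mul0r addr0 mul1r.
apply: le_trans; rewrite exprSr -mulrA ler_wpM2l ?exprn_ge0 //.
rewrite -subr_ge0 [X in 0 <= X](_ : _ = (1 - r) ^+ 2 * n.+1%:R).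
  by rewrite mulr_ge0 ?exprn_ge0 ?ler0n // ltW.
by rewrite -addn1 natrD; ring.
Qed.

(** If [y = (h + y^2) / 2] then [(1 - y)^2 = 1 - h].  On the ball of radius
[r < 1] the map [F] below is a contraction of ratio [r], because
[a^2 - b^2 = a (a - b) + (a - b) b] even when [a] and [b] do not commute. *)
Section SquareRoot.
Variables (h : A) (r : C).
Hypotheses (h_star : star h = h) (h_le : `|h| <= r) (r_lt1 : r < 1).

Let F y : A := 2^-1 *: (h + y * y).
Let y n := iter n F 0.
Let r0 : 0 <= r. Proof. exact: le_trans (normr_ge0 _) h_le. Qed.

Let normM a b : `|a * b| <= `|a| * `|b|. Proof. exact: cstar_normM. Qed.

Let c2 : `|2^-1 : C| = 2^-1. Proof. by rewrite ger0_norm ?invr_ge0 ?ler0n. Qed.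

Let half (s : C) : 2^-1 * (s + s) = s. Proof. by field. Qed.

Lemma sqrt_iter_bound n : `|y n| <= r.
Proof.
elim: n => [|n IH]; first by rewrite normr0.
rewrite /y iterS -/(y n) /F normrZ c2 -[leRHS]half ler_wpM2l ?invr_ge0 ?ler0n //.
apply: le_trans (ler_normD _ _) _; rewrite lerD //.
apply: le_trans (normM _ _) _; rewrite -[leRHS]mulr1.
by rewrite ler_pM ?normr_ge0 // (le_trans IH) ?ltW.
Qed.

Lemma sqrt_iter_star n : star (y n) = y n.
Proof.
elim: n => [|n IH]; first exact: star0.
rewrite /y iterS -/(y n) /F starZ starD h_star starMr IH.
by rewrite fmorphV /= rmorph_nat.
Qed.

Lemma sqrt_step_contracts a b : `|a| <= r -> `|b| <= r -> `|F a - F b| <= r * `|a - b|.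
Proof.
move=> ar br; rewrite /F -scalerBr normrZ c2.
have -> : h + a * a - (h + b * b) = a * (a - b) + (a - b) * b.
  by rewrite mulrBr mulrBl addrA subrK opprD addrACA subrr add0r.
rewrite -[leRHS]half ler_wpM2l ?invr_ge0 ?ler0n //.
apply: le_trans (ler_normD _ _) _; rewrite lerD //.
  by apply: le_trans (normM _ _) _; rewrite ler_wpM2r.
by apply: le_trans (normM _ _) _; rewrite mulrC ler_wpM2r.
Qed.

Lemma sqrt_iter_dist n k : `|y (n + k) - y n| <= r ^+ n * r.
Proof.
elim: n => [|n IH]; first by rewrite expr0 mul1r subr0 sqrt_iter_bound.
rewrite addSn /y !iterS -/(y n) -/(y (n + k)) exprS -mulrA.
apply: le_trans (sqrt_step_contracts _ _) _; rewrite ?sqrt_iter_bound //.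
by rewrite ler_wpM2l.
Qed.

Lemma cstar_sqrt : exists2 d, star d = d & d * d = 1 - h.
Proof.
have d0 : 0 < 1 - r by rewrite subr_gt0.
have dist_rate m n : (n <= m)%N -> `|y m - y n| <= (1 - r)^-1 * rate R n.
  move=> nm; rewrite -(subnKC nm); apply: le_trans (sqrt_iter_dist _ _) _.
  rewrite -ler_pdivrMl ?invr_gt0 // invrK mulrC; apply: le_trans (bernoulli n r0 r_lt1).
  by rewrite ler_wpM2r ?(ltW d0) // ler_piMr ?exprn_ge0 // ltW.
have yc : cvgn y.
  apply: cauchy_cvg; apply: (@rate_cauchy _ _ _ ((1 - r)^-1 ^+ 2)) => m n.
  wlog nm : m n / (n <= m)%N.
    by move=> W; case: (leqP n m) => [|/ltnW] /W //; rewrite distrC [rate R m + _]addrC.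
  apply: (@le_trans _ _ (((1 - r)^-1 * rate R n) ^+ 2)).
    by rewrite lerXn2r ?nnegrE ?dist_rate // mulr_ge0 ?rate_ge0 // invr_ge0 ltW.
  rewrite exprMn ler_wpM2l ?exprn_ge0 ?invr_ge0 ?(ltW d0) //.
  apply: (@le_trans _ _ (rate R n)); last by rewrite lerDr rate_ge0.
  by rewrite expr2 ler_piMr ?rate_ge0 // invf_le1 ?ler1n ?ltr0n.
have /cvgrPdist_lt yl := yc.
set l := limn y in yl.
have eq_small a b : (forall e : C, 0 < e -> `|a - b| < e) -> a = b.
  move=> ab; apply/eqP; rewrite -subr_eq0 -normr_eq0; apply/negPn/negP => abN0.
  have /ab : 0 < `|a - b| by rewrite lt_def abN0 normr_ge0.
  by rewrite ltxx.
have l_star : star l = l.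
  apply: eq_small => e e0; have [N _ /(_ N (leqnn N)) /= hN] := yl _ (divr_gt0 e0 (ltr0n C 2)).
  rewrite [ltRHS]splitr; apply: le_lt_trans (ler_distD (y N) _ _) _.
  apply: ltrD; last by rewrite distrC.
  by rewrite -[y N]sqrt_iter_star -starB star_norm.
have l_le : `|l| <= r.
  apply: (tends_le _ (tends_cst r) sqrt_iter_bound); constructor.
  apply/cvgrPdist_lt => e /yl; apply: filterS => n /=.
  exact: le_lt_trans (ler_dist_dist _ _).
have l_fix : F l = l.
  apply: eq_small => e e0; have [N _ hN] := yl _ (divr_gt0 e0 (ltr0n C 2)).
  rewrite [ltRHS]splitr; apply: le_lt_trans (ler_distD (y N.+1) _ _) _.
  apply: ltrD; last by rewrite distrC; apply: (hN N.+1) => /=.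
  apply: le_lt_trans (hN N (leqnn N)); apply: le_trans (sqrt_step_contracts _ _) _ => //.
    exact: sqrt_iter_bound.
  by rewrite ler_piMl // ltW.
exists (1 - l); first by rewrite starB star1 l_star.
have l2 : h + l * l = l *+ 2.
  by rewrite -[in RHS]l_fix /F -scaler_nat scalerA divff ?scale1r ?pnatr_eq0.
rewrite mulrBr mulr1 mulrBl mul1r -(addrK (l * l) h) l2.
rewrite mulr2n !opprB. by rewrite opprD -addrA; congr (_ + _); rewrite addrCA.
Qed.
End SquareRoot.

Lemma cstar_complement c : `|c| < 1 -> exists d, star c * c + star d * d = 1.
Proof.
move=> c1; have [||| d ds dd] := @cstar_sqrt (star c * c) (`|c| ^+ 2).
- by rewrite starMr starK.
- by rewrite -cstar_norm_star.
- by rewrite exprn_ilt1.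
- by exists d; rewrite ds dd addrC subrK.
Qed.
End CStar.

(** * The kernel of the dilation *)

Section DilationKernel.
Variables (R : realType) (A : cstarAlgType R) (H : hilbertType R).
Variables (phi : A -> boundedOp H H) (k : nat).
Variables (beta : 'I_k -> starAut A) (T : 'I_k -> boundedOp H H).
Local Notation C := R[i].
Hypothesis phi_cp : completely_positive phi.
Hypothesis phi_inv : forall a x,
  phi a x = \sum_(i < k) T i (phi (starAut_inv (beta i) a) (adj (T i) x)).

Notation binv i := (starAut_inv (beta i)).

Lemma binv_linear i c a b : binv i (c *: a + b) = c *: binv i a + binv i b.
Proof.
apply: (can_inj (starAutK (beta i))).
by have [-> _ _] := starAut_endo (beta i); rewrite !starAutVK.
Qed.

Lemma binvM i a b : binv i (a * b) = binv i a * binv i b.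
Proof.
apply: (can_inj (starAutK (beta i))).
by have [_ -> _] := starAut_endo (beta i); rewrite !starAutVK.
Qed.

Lemma binv_star i a : binv i (star a) = star (binv i a).
Proof.
apply: (can_inj (starAutK (beta i))).
by have [_ _ ->] := starAut_endo (beta i); rewrite !starAutVK.
Qed.

Lemma binv1 i : binv i 1 = 1.
Proof.
rewrite -[LHS]mulr1 -{2}[1](starAutK (beta i)) -binvM mul1r.
by rewrite starAutK.
Qed.

Let X : choiceType := (seq 'I_k * (A * H))%type.
Implicit Types x y : X.

(** [V_w^* pi(a) = pi(word_shift w a) V_w^*]: the first letter of [w] acts first. *)
Definition word_shift (w : seq 'I_k) (a : A) := foldl (fun b i => binv i b) a w.

Lemma word_shift_linear w c a b :
  word_shift w (c *: a + b) = c *: word_shift w a + word_shift w b.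
Proof. by elim: w a b => //= i w IH a b; rewrite binv_linear IH. Qed.

Lemma word_shiftM w a b : word_shift w (a * b) = word_shift w a * word_shift w b.
Proof. by elim: w a b => //= i w IH a b; rewrite binvM IH. Qed.

Lemma word_shift1 w : word_shift w 1 = 1.
Proof. by elim: w => //= i w IH; rewrite binv1 IH. Qed.

(** A generator [(w, (a, h))] stands for the vector [V_w pi(a) h]; [shift],
[coshift] and [act] are the actions of [V_i], [V_i^*] and [pi(c)] on
generators.  The zero vector is represented by a triple with [a = h = 0], which
makes [coshift] and [act] commute exactly. *)
Definition shift i x : X := (i :: x.1, x.2).

Definition coshift i x : X :=
  match x with
  | ([::], (a, h)) => ([::], (binv i a, adj (T i) h))
  | (j :: w, ah) => if i == j then (w, ah) else (w, (0, 0))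
  end.

Definition act c x : X := (x.1, (word_shift x.1 c * x.2.1, x.2.2)).

Lemma coshift_act i c x : coshift i (act c x) = act (binv i c) (coshift i x).
Proof.
case: x => [[|j w] [a h]] /=; first by rewrite /act /= binvM.
by rewrite /act /=; case: eqP => [->|] //=; rewrite mulr0.
Qed.

Lemma size_coshift i x : size (coshift i x).1 = (size x.1).-1.
Proof. by case: x => [[|j w] [a h]] //=; case: eqP. Qed.

(** Level [0] forgets the words; this is the intended inner product only when
both words are empty, a state that [n] coshifts reach from words of length at
most [n]. *)
Fixpoint level_kernel n x y : C :=
  if n is m.+1 then \sum_(i < k) level_kernel m (coshift i x) (coshift i y)
  else inner (phi (star y.2.1 * x.2.1) x.2.2) y.2.2.

(** The base case is the hypothesis that [phi] is reproduced by [T] and [beta]. *)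
Lemma level_kernel_stable n x y : (size x.1 <= n)%N -> (size y.1 <= n)%N ->
  level_kernel n.+1 x y = level_kernel n x y.
Proof.
elim: n x y => [|n IH] x y.
  case: x y => [[|//] [a h]] [[|//] [b g]] _ _ /=.
  rewrite phi_inv linear_sumlz; apply: eq_bigr => i _.
  by rewrite -binv_star -binvM -adjP.
move=> xn yn; rewrite -[LHS]/(\sum_(i < k) level_kernel n.+1 (coshift i x) (coshift i y)).
by apply: eq_bigr => i _; rewrite IH // size_coshift -subn1 leq_subLR add1n.
Qed.

Definition dilation_kernel x y := level_kernel (maxn (size x.1) (size y.1)) x y.
Local Notation K := dilation_kernel.

Lemma dilation_kernelE n x y : (size x.1 <= n)%N -> (size y.1 <= n)%N ->
  K x y = level_kernel n x y.
Proof.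
move=> xn yn; have : (maxn (size x.1) (size y.1) <= n)%N by rewrite geq_max xn.
elim: n {xn yn} => [|n IH]; first by rewrite leqn0 => /eqP mn; rewrite /K mn.
rewrite leq_eqVlt => /orP[/eqP mn | mn]; first by rewrite /K mn.
rewrite ltnS in mn; rewrite (IH mn) level_kernel_stable //.
  by apply: leq_trans mn; apply: leq_maxl.
by apply: leq_trans mn; apply: leq_maxr.
Qed.

Lemma dilation_kernel_coshift x y : K x y = \sum_(i < k) K (coshift i x) (coshift i y).
Proof.
pose n := maxn (size x.1) (size y.1).
rewrite (@dilation_kernelE n.+1) ?(leqW (leq_maxl _ _)) ?(leqW (leq_maxr _ _)) //.
apply: eq_bigr => i _; rewrite (@dilation_kernelE n) // size_coshift.
  by apply: leq_trans (leq_pred _) _; apply: leq_maxl.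
by apply: leq_trans (leq_pred _) _; apply: leq_maxr.
Qed.

Lemma phi_linear c a b h : phi (c *: a + b) h = c *: phi a h + phi b h.
Proof. by case: phi_cp => ->. Qed.

Lemma adj_0 i : adj (T i) 0 = 0.
Proof. by apply: adj_eq => x; rewrite !linear0r. Qed.

Lemma level_kernel_null n x y : x.2.2 = 0 -> level_kernel n x y = 0.
Proof.
elim: n x y => [|n IH] x y x0 /=; first by rewrite x0 linear0 linear0l.
apply: big1 => i _; apply: IH; case: x x0 => [[|j w] [a h]] /= ->; first exact: adj_0.
by case: eqP.
Qed.

Lemma dilation_kernel_null x y : x.2.2 = 0 -> K x y = 0.
Proof. exact: level_kernel_null. Qed.

Lemma dilation_kernel_linear_alg w c a b h y :
  K (w, (c *: a + b, h)) y = c * K (w, (a, h)) y + K (w, (b, h)) y.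
Proof.
have := leq_maxl (size w) (size y.1); have := leq_maxr (size w) (size y.1).
move: (maxn _ _) => n yn wn; rewrite !(@dilation_kernelE n) //.
elim: n w a b h y {yn wn} => [|n IH] w a b h y /=.
  by rewrite mulrDr -cscalerAr phi_linear linearPl.
rewrite mulr_sumr -big_split; apply: eq_bigr => i _.
case: w => [|j w] /=; first by rewrite binv_linear IH.
by case: eqP => _; [exact: IH | rewrite !level_kernel_null // mulr0 addr0].
Qed.

Lemma dilation_kernel_linear_vec w c a h g y :
  K (w, (a, c *: h + g)) y = c * K (w, (a, h)) y + K (w, (a, g)) y.
Proof.
have := leq_maxl (size w) (size y.1); have := leq_maxr (size w) (size y.1).
move: (maxn _ _) => n yn wn; rewrite !(@dilation_kernelE n) //.
elim: n w a h g y {yn wn} => [|n IH] w a h g y /=.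
  by rewrite linearP linearPl.
rewrite mulr_sumr -big_split; apply: eq_bigr => i _.
case: w => [|j w] /=; first by rewrite adj_linear IH.
by case: eqP => _; [exact: IH | rewrite !level_kernel_null // mulr0 addr0].
Qed.

(** Complete positivity for the matrix [a_i^* a_j], which is [b^* b] for the
matrix [b] with first row [(a_j)] and zeros below; scalars go into [h]. *)
Lemma level0_psd s : 0 <= kernel_form (level_kernel 0) s s.
Proof.
case: s => [|p0 s0]; first by rewrite /kernel_form big_nil.
set s := p0 :: s0; pose n := size s0.
pose a (i : 'I_n.+1) := (tnth (in_tuple s) i).2.2.1.
pose h (i : 'I_n.+1) := (tnth (in_tuple s) i).1 *: (tnth (in_tuple s) i).2.2.2.
have pos : mx_positive (\matrix_(i, j) (star (a i) * a j) : 'M[A]_n.+1).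
  exists (\matrix_(i, j) (if i == ord0 then a j else 0)); apply/matrixP => i j.
  rewrite !mxE (bigD1 ord0) //= big1 ?addr0; last first.
    by move=> l lN0; rewrite !mxE (negbTE lN0) mulr0.
  by rewrite !mxE eqxx.
have [_ /(_ n.+1 _ pos h)] := phi_cp.
congr (0 <= _); rewrite /kernel_form exchange_big [RHS]big_tnth.
apply: eq_bigr => i _; rewrite linear_sumlz [RHS]big_tnth; apply: eq_bigr => j _.
by rewrite !mxE /h [phi _ _]linearZ linearZl_LR linearZr_LR /= mulrA.
Qed.

Lemma level_kernel_psd n s : 0 <= kernel_form (level_kernel n) s s.
Proof.
elim: n s => [|n IH] s; first exact: level0_psd.
have -> : kernel_form (level_kernel n.+1) s s = \sum_(i < k)
   kernel_form (level_kernel n) [seq (p.1, coshift i p.2) | p <- s]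
                                [seq (p.1, coshift i p.2) | p <- s].
  rewrite /kernel_form; under [RHS]eq_bigr do rewrite big_map.
  rewrite [RHS]exchange_big; apply: eq_bigr => p _ /=.
  under [RHS]eq_bigr do rewrite big_map.
  by rewrite [RHS]exchange_big; apply: eq_bigr => p' _ /=; rewrite mulr_sumr.
by apply: sumr_ge0 => i _; exact: IH.
Qed.

Lemma dilation_kernel_psd s : 0 <= kernel_form K s s.
Proof.
pose N := \max_(p <- s) size p.2.1.
rewrite [X in 0 <= X](_ : _ = kernel_form (level_kernel N) s s).
  exact: level_kernel_psd.
rewrite /kernel_form !big_seq; apply: eq_bigr => p ps.
rewrite !big_seq; apply: eq_bigr => p' p's; congr (_ * _).
apply: dilation_kernelE.
  exact: (@leq_bigmax_seq _ _ xpredT (fun p : C * X => size p.2.1)).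
exact: (@leq_bigmax_seq _ _ xpredT (fun p : C * X => size p.2.1)).
Qed.

Lemma dilation_kernel_herm x y : K x y = (K y x)^*.
Proof. exact: psd_kernel_herm dilation_kernel_psd _ _. Qed.

(** Only the summand [j = i] survives in [dilation_kernel_coshift], and there
[coshift i] undoes [shift i]. *)
Lemma kernel_shiftl i x y : K (shift i x) y = K x (coshift i y).
Proof.
rewrite dilation_kernel_coshift (bigD1 i) //= big1 ?addr0; last first.
  by move=> j ji; rewrite (negbTE ji) dilation_kernel_null.
by rewrite eqxx; case: x => w [a h].
Qed.

Lemma kernel_actl c x y : K (act c x) y = K x (act (star c) y).
Proof.
have := leq_maxl (size x.1) (size y.1); have := leq_maxr (size x.1) (size y.1).
move: (maxn _ _) => n yn xn; rewrite !(@dilation_kernelE n) //.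
elim: n c x y xn yn => [|n IH] c x y xn yn.
  case: x y xn yn => [[|//] [a h]] [[|//] [b g]] _ _ /=.
  by rewrite starMr starK mulrA.
rewrite -[LHS]/(\sum_(i < k) level_kernel n (coshift i (act c x)) (coshift i y)).
apply: eq_bigr => i _; rewrite !coshift_act IH ?binv_star //.
  by rewrite size_coshift -subn1 leq_subLR add1n.
by rewrite size_coshift -subn1 leq_subLR add1n.
Qed.

Lemma coshift_bound i s :
  kernel_form K [seq (p.1, coshift i p.2) | p <- s] [seq (p.1, coshift i p.2) | p <- s]
  <= 1 * kernel_form K s s.
Proof.
rewrite mul1r [leRHS](_ : _ = \sum_(i < k)
   kernel_form K [seq (p.1, coshift i p.2) | p <- s]
                 [seq (p.1, coshift i p.2) | p <- s]); last first.
  rewrite /kernel_form; under [RHS]eq_bigr do rewrite big_map.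
  rewrite [RHS]exchange_big; apply: eq_bigr => p _ /=.
  under [RHS]eq_bigr do rewrite big_map.
  rewrite [RHS]exchange_big; apply: eq_bigr => p' _ /=; rewrite -mulr_sumr.
  by rewrite -dilation_kernel_coshift.
rewrite (bigD1 i) //= lerDl; apply: sumr_ge0 => j _; exact: dilation_kernel_psd.
Qed.

Lemma act_linear c a b x y :
  K (act (c *: a + b) x) y = c * K (act a x) y + K (act b x) y.
Proof.
rewrite /act word_shift_linear mulrDl -cscalerAl.
exact: dilation_kernel_linear_alg.
Qed.

Lemma act_comp a b x : act a (act b x) = act (a * b) x.
Proof. by rewrite /act /= word_shiftM mulrA. Qed.

Lemma act1 x : act 1 x = x.
Proof. by case: x => w [a h]; rewrite /act word_shift1 mul1r. Qed.

Lemma act_form c s :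
  kernel_form K [seq (p.1, act c p.2) | p <- s] [seq (p.1, act c p.2) | p <- s] =
  \sum_(p <- s) \sum_(p' <- s) p.1 * p'.1^* * K (act (star c * c) p.2) p'.2.
Proof.
rewrite /kernel_form big_map; apply: eq_bigr => p _; rewrite big_map.
apply: eq_bigr => p' _ /=.
by rewrite -act_comp [K (act (star c) _) _]kernel_actl starK.
Qed.

(** For [|c| < t], adding the forms of [c x / t] and [d x], where
[1 = (c / t)^* (c / t) + d^* d], gives the form of [x]. *)
Lemma act_bound c s :
  kernel_form K [seq (p.1, act c p.2) | p <- s] [seq (p.1, act c p.2) | p <- s]
  <= (`|c| + 1) ^+ 2 * kernel_form K s s.
Proof.
set t := `|c| + 1; have t0 : 0 < t by rewrite ltr_wpDl.
have [|d cd] := @cstar_complement _ _ (t^-1 *: c).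
  by rewrite normrZ gtr0_norm ?invr_gt0 // mulrC ltr_pdivrMr // mul1r ltrDl.
have {}cd : 1 = t^-1 ^+ 2 *: (star c * c) + star d * d.
  rewrite -cd; congr (_ + _); rewrite starZ [in RHS]expr2 -scalerA.
  rewrite -cscalerAr -cscalerAl; congr (_ *: (_ *: _)).
  by apply/CrealP; rewrite realV gtr0_real.
have -> : kernel_form K s s = t^-1 ^+ 2 *
    kernel_form K [seq (p.1, act c p.2) | p <- s] [seq (p.1, act c p.2) | p <- s] +
    kernel_form K [seq (p.1, act d p.2) | p <- s] [seq (p.1, act d p.2) | p <- s].
  rewrite !act_form /kernel_form mulr_sumr -big_split; apply: eq_bigr => p _ /=.
  rewrite mulr_sumr -big_split; apply: eq_bigr => p' _ /=.
  by rewrite -[K p.2 _]/(K p.2 p'.2) -[p.2 in LHS]act1 cd act_linear; ring.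
rewrite mulrDr mulrA -exprMn divff ?gt_eqF // expr1n mul1r lerDl.
by rewrite mulr_ge0 ?exprn_ge0 ?(ltW t0) ?dilation_kernel_psd.
Qed.

End DilationKernel.

(** * The dilation *)

Section Compression.
Variables (R : realType) (H K : hilbertType R) (J : {linear H -> K}).

Lemma isometric_of_inner (V : H -> K) :
  (forall x, inner (V x) (V x) = inner x x) -> isometric V.
Proof.
move=> VE x; apply/eqP; rewrite -(@eqrXn2 _ 2) ?normr_ge0 //.
by rewrite -!inner_normE VE.
Qed.

Lemma compression_of_inner (V : K -> K) (S : H -> H) :
  (forall x m, inner (V (J x)) (J m) = inner (J (S x)) (J m)) ->
  is_compression J V S.
Proof.
move=> VS x; apply/esym/xget_unique.
  split=> [|_ [m _ <-]]; first by exists (S x).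
  by rewrite linearBl /= VS subrr.
move=> _ [[u _ <-] hu]; apply/eqP; rewrite -subr_eq0 -raddfB.
rewrite -(@dnorm_eq0 _ _ inner) [X in inner X _](_ : _ =
   (V (J x) - J (S x)) - (V (J x) - J u)); last first.
  by rewrite raddfB opprB [RHS]addrC addrA subrK.
rewrite linearBl /= hu ?subr0; last by exists (u - S x).
by rewrite linearBl /= VS subrr.
Qed.
End Compression.

Theorem corollary7p7 (R : realType) (A : cstarAlgType R) (H : hilbertType R)
    (phi : A -> boundedOp H H) (k : nat)
    (beta : 'I_k -> starAut A) (T : 'I_k -> boundedOp H H) :
  completely_positive phi -> op_unital phi ->
  (forall i, contractive (T i)) ->
  (forall a x, phi a x =
     \sum_(i < k) T i (phi (starAut_inv (beta i) a) (adj (T i) x))) ->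
  exists (K : hilbertType R) (J : {linear H -> K})
         (pi : A -> boundedOp K K) (V : 'I_k -> boundedOp K K),
    isometric J /\
    star_representation pi /\
    (forall i, isometric (V i)) /\
    orthogonal_ranges V /\
    (forall a x, pi a x =
       \sum_(i < k) V i (pi (starAut_inv (beta i) a) (adj (V i) x))) /\
    map_dilation J pi phi /\
    tuple_dilation J V T /\
    coinvariant J V.
Proof.
move=> cp un _ inv.
pose kn := dilation_kernel phi beta T.
have [K [pt [ptE pt_total pt_op]]] := kernel_space (dilation_kernel_psd cp inv).
have pt_eq g g' : (forall x, inner g (pt x) = inner g' (pt x)) -> g = g'.
  move=> gg; apply/eqP; rewrite -subr_eq0; apply/eqP; apply: pt_total => x.
  by rewrite linearBl /= gg subrr.
have op_pt (S : boundedOp K K) (F G : seq 'I_k * (A * H) -> seq 'I_k * (A * H)) :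
    (forall x y, kn (F x) y = kn x (G y)) ->
    (forall g x, inner (S g) (pt x) = inner g (pt (G x))) ->
    forall x, S (pt x) = pt (F x).
  by move=> FG SG x; apply: pt_eq => y; rewrite SG !ptE; exact/esym/FG.
(* Adjoints are tested on generators only, so they need no extension lemma. *)
have adj_pt (S : boundedOp K K) (F : seq 'I_k * (A * H) -> seq 'I_k * (A * H)) :
    (forall x, S (pt x) = pt (F x)) ->
    forall g x, inner (adj S g) (pt x) = inner g (pt (F x)).
  by move=> SF g x; rewrite innerC -adjP SF -innerC.
have /choice[V V_in] (i : 'I_k) : exists S : boundedOp K K, forall g x,
    inner (S g) (pt x) = inner g (pt (coshift beta T i x)).
  apply: pt_op (ler01) _ _ => [x y | s]; first exact: kernel_shiftl.
  exact: coshift_bound.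
have /choice[pi pi_in] (a : A) : exists S : boundedOp K K, forall g x,
    inner (S g) (pt x) = inner g (pt (act beta (star a) x)).
  apply: pt_op => [|x y | s]; last exact: act_bound.
    by rewrite exprn_ge0 // addr_ge0.
  exact: kernel_actl.
have V_pt i : forall x, V i (pt x) = pt (shift i x).
  by apply: op_pt (V_in i) => x y; exact: kernel_shiftl.
have pi_pt a : forall x, pi a (pt x) = pt (act beta a x).
  by apply: op_pt (pi_in a) => x y; exact: kernel_actl.
have adjV_in i : forall g x, inner (adj (V i) g) (pt x) = inner g (pt (shift i x)).
  exact: adj_pt.
have adjpi_in a : forall g x, inner (adj (pi a) g) (pt x) = inner g (pt (act beta a x)).
  exact: adj_pt.
have adjV_pt i x : adj (V i) (pt x) = pt (coshift beta T i x).
  apply: pt_eq => y; rewrite adjV_in !ptE dilation_kernel_herm //.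
  by rewrite kernel_shiftl // -dilation_kernel_herm.
have pt_null w a : pt (w, (a, 0)) = 0.
  by apply: pt_eq => y; rewrite ptE linear0l; exact: dilation_kernel_null.
have pt_alg c w a b h : pt (w, (c *: a + b, h)) = c *: pt (w, (a, h)) + pt (w, (b, h)).
  by apply: pt_eq => y; rewrite linearPl /= !ptE; exact: dilation_kernel_linear_alg.
have pt_vec c w a h g : pt (w, (a, c *: h + g)) = c *: pt (w, (a, h)) + pt (w, (a, g)).
  by apply: pt_eq => y; rewrite linearPl /= !ptE; exact: dilation_kernel_linear_vec.
(* [sum_i V_i V_i^* = 1] on generators: the Cuntz relation. *)
have pt_split x : pt x = \sum_(i < k) pt (shift i (coshift beta T i x)).
  apply: pt_eq => y; rewrite linear_sumlz ptE dilation_kernel_coshift //.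
  by apply: eq_bigr => i _; rewrite [RHS]ptE kernel_shiftl.
pose J h := pt ([::], (1, h)).
have J_lin : linear J by move=> c h g; exact: pt_vec.
pose Jl : {linear H -> K} := HB.pack J (GRing.isLinear.Build _ _ _ _ J J_lin).
have J_inner h g : inner (Jl h) (Jl g) = inner h g.
  by rewrite ptE /= /dilation_kernel /= star1 mulr1 un.
have adjV_J i h : adj (V i) (J h) = J (adj (T i) h).
  by rewrite adjV_pt /= binv1.
have adjV_V i j g : adj (V i) (V j g) = if i == j then g else 0.
  apply: pt_eq => x; rewrite adjV_in V_in /= eq_sym.
  case: eqP => _; first by case: x => w [a h].
  by rewrite pt_null linear0r linear0l.
exists K, Jl, pi, V; split; last split; last split; last split; last split;
  last split; last split.
- by apply: isometric_of_inner => h; rewrite J_inner.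
- split=> [c a b g | a b g | a g].
  + apply: pt_eq => -[w [a' h]]; rewrite linearPl !pi_in /act.
    rewrite starD starZ word_shift_linear mulrDl -cscalerAl pt_alg linearPr /=.
    by rewrite conjCK !pi_in.
  + by apply: pt_eq => x; rewrite !pi_in starMr act_comp.
  + by apply: pt_eq => x; rewrite adjpi_in pi_in starK.
- by move=> i; apply: isometric_of_inner => g; rewrite adjP adjV_V eqxx.
- by move=> i j ij x y; rewrite adjP adjV_V (negbTE ij) linear0r.
- move=> a g; apply: pt_eq => x; rewrite pi_in [in LHS]pt_split linear_sumr linear_sumlz.
  apply: eq_bigr => i _; rewrite [RHS]V_in [RHS]pi_in [RHS]adjV_in.
  by rewrite coshift_act binv_star.
- move=> a; apply: compression_of_inner => x m.
  by rewrite J_inner pi_pt ptE /dilation_kernel /= star1 mul1r mulr1.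
- move=> w; apply: compression_of_inner => x m; rewrite J_inner.
  elim: w m => [|i w IH] m /=; first exact: J_inner.
  by rewrite adjP [adj _ _]adjV_J IH -adjP.
- by move=> i x; exists (adj (T i) x) => //; rewrite [RHS]adjV_J.
Qed.
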